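(* There is a computable linear order $\mathcal{L}$ such that for every cohesive set $C \subseteq \mathbb{N}$ and every presentation $\mathcal{P}$ of the cohesive power $\prod_C \mathcal{L}$, the double-jump $\mathcal{P}''$ has PA-degree relative to $0''$. Thus $\prod_C \mathcal{L}$ has no computable presentation for any cohesive set $C$.
   Context: $0''$ denotes the double Turing jump of the empty set, and $\mathcal{P}''$ the double Turing jump of (the set encoding) $\mathcal{P}$. Linear orders are viewed as structures in the language with one binary relation symbol for the strict order $\prec$. PA-degree: Let $(\varphi_e^g)_{e \in \mathbb{N}}$ be the standard enumeration of the functions partial computable relative to $g : \mathbb{N} \to \mathbb{N}$. A function $f : \mathbb{N} \to \{0,1\}$ is $\mathrm{DNC}_2$ relative to $g$ if for all $e$, if $\varphi_e^g(e)$ is defined then $f(e) \neq \varphi_e^g(e)$. A function $f : \mathbb{N} \to \mathbb{N}$ has PA-degree relative to $g$ if $f$ computes a function that is $\mathrm{DNC}_2$ relative to $g$. Sets are identified with their characteristic functions. Presentations: A presentation (or copy) of a countable structure $\mathcal{M}$ is an isomorphic copy of $\mathcal{M}$ whose domain is a non-empty subset of $\mathbb{N}$. A structure with domain contained in $\mathbb{N}$ is identified with the subset of $\mathbb{N}$ encoding (as an effective join) its domain and its relations; computability-theoretic terms applied to such a structure refer to this set. Cohesive sets: $X \subseteq^* Y$ means $X \setminus Y$ is finite. A set $C \subseteq \mathbb{N}$ is cohesive if it is infinite and for every computably enumerable set $W$, either $C \subseteq^* W$ or $C \subseteq^* \mathbb{N} \setminus W$. Cohesive power: Let $\mathcal{L}$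 be a computable linear order with domain $|\mathcal{L}|$, and let $C$ be cohesive. Let $D$ be the set of partial computable functions $\varphi : \mathbb{N} \to \mathbb{N}$ such that $\varphi(n) \in |\mathcal{L}|$ whenever $\varphi(n)$ is defined, and $C \subseteq^* \mathrm{dom}(\varphi)$. For $\varphi, \psi \in D$ let $\varphi =_C \psi$ mean $C \subseteq^* \{n : \varphi(n) \text{ and } \psi(n) \text{ are defined and equal}\}$; this is an equivalence relation, and $[\varphi]$ denotes the class of $\varphi$. The cohesive power $\prod_C \mathcal{L}$ has domain $\{[\varphi] : \varphi \in D\}$, with $[\varphi] \prec [\psi]$ iff $C \subseteq^* \{n : \varphi(n), \psi(n) \text{ are defined and } \varphi(n) \prec_{\mathcal{L}} \psi(n)\}$. It is again a linear order. *)

(* Defs.v *)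
From mathcomp Require Import all_boot.
From mathcomp Require Import boolp classical_sets functions cardinality.
From Stdlib Require Cantor.

Set Implicit Arguments.
Unset Strict Implicit.
Unset Printing Implicit Defensive.

Local Open Scope classical_set_scope.

(* Partial functions are represented by their graphs: [phi n m] reads
   "phi(n) is defined and equal to m". *)
Definition pfun := nat -> nat -> Prop.

Definition pdom (phi : pfun) : set nat := [set n | exists m, phi n m].

Definition npair (x y : nat) : nat := Cantor.to_nat (x, y).

(* Programs for the unary partial recursive functions with an oracle; several
   arguments are passed as one, through Cantor pairing. *)
Inductive code : Type :=
  | CZero | CSucc | CLeft | CRight | COracle
  | CPair of code & code
  | CComp of code & code
  | CPrec of code & code
  | CMu of code.

Fixpoint prim_rec (F G : pfun) (x k m : nat) : Prop :=
  match k with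
  | 0 => F x m
  | j.+1 => exists2 i, prim_rec F G x j i & G (npair x (npair j i)) m
  end.

(* Minimization requires every earlier value to be defined and nonzero. *)
Definition minimize (F : pfun) (x k : nat) : Prop :=
  F (npair x k) 0 /\ forall j, j < k -> exists i, F (npair x j) i.+1.

Fixpoint eval (g : nat -> nat) (c : code) : pfun :=
  match c with
  | CZero => fun n m => m = 0
  | CSucc => fun n m => m = n.+1
  | CLeft => fun n m => m = (Cantor.of_nat n).1
  | CRight => fun n m => m = (Cantor.of_nat n).2
  | COracle => fun n m => m = g n
  | CPair a b => fun n m =>
      exists x y, [/\ eval g a n x, eval g b n y & m = npair x y]
  | CComp a b => fun n m => exists2 x, eval g b n x & eval g a x m
  | CPrec a b => fun n m =>
      prim_rec (eval g a) (eval g b)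
               (Cantor.of_nat n).1 (Cantor.of_nat n).2 m
  | CMu a => minimize (eval g a)
  end.

Lemma eval_functional g c n m1 m2 : eval g c n m1 -> eval g c n m2 -> m1 = m2.
Proof.
elim: c n m1 m2 => [||||| a IHa b IHb | a IHa b IHb | a IHa b IHb | a IHa] n m1 m2 /=;
  try by move=> -> ->.
- move=> [x1 [y1 [ax1 by1 ->]]] [x2 [y2 [ax2 by2 ->]]].
  by rewrite (IHa _ _ _ ax1 ax2) (IHb _ _ _ by1 by2).
- by move=> [x1 bx1 am1] [x2 bx2 am2]; rewrite -(IHb _ _ _ bx1 bx2) in am2; exact: IHa am1 am2.
- elim: (Cantor.of_nat n).2 m1 m2 => [|k IHk] m1 m2 /=; first exact: IHa.
  move=> [i1 r1 bm1] [i2 r2 bm2]; rewrite -(IHk _ _ r1 r2) in bm2; exact: IHb bm1 bm2.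
- move=> [z1 l1] [z2 l2]; case: (ltngtP m1 m2) => // lt.
  + by have [i nz] := l2 _ lt; have := IHa _ _ _ z1 nz.
  + by have [i nz] := l1 _ lt; have := IHa _ _ _ z2 nz.
Qed.

(* Every number codes a program: the number <t, <a, b>> has constructor tag t
   and subprograms coded by a and b.  When t > 0 these are smaller than the
   number itself, so e.+1 units of fuel suffice to decode e. *)
Fixpoint decode_fuel (fuel e : nat) : code :=
  if fuel is fuel'.+1 then
    let: (t, r) := Cantor.of_nat e in
    let: (a, b) := Cantor.of_nat r in
    match t with
    | 0 => CZero
    | 1 => CSucc
    | 2 => CLeft
    | 3 => CRight
    | 4 => COracle
    | 5 => CPair (decode_fuel fuel' a) (decode_fuel fuel' b)
    | 6 => CComp (decode_fuel fuel' a) (decode_fuel fuel' b)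
    | 7 => CPrec (decode_fuel fuel' a) (decode_fuel fuel' b)
    | _ => CMu (decode_fuel fuel' a)
    end
  else CZero.

Definition decode (e : nat) : code := decode_fuel e.+1 e.

Fixpoint encode (c : code) : nat :=
  match c with
  | CZero => npair 0 0
  | CSucc => npair 1 0
  | CLeft => npair 2 0
  | CRight => npair 3 0
  | COracle => npair 4 0
  | CPair a b => npair 5 (npair (encode a) (encode b))
  | CComp a b => npair 6 (npair (encode a) (encode b))
  | CPrec a b => npair 7 (npair (encode a) (encode b))
  | CMu a => npair 8 (npair (encode a) 0)
  end.

Lemma npair_bounds t a b :
  (a < npair t.+1 (npair a b)) /\ (b < npair t.+1 (npair a b)).
Proof.
have h x y : y + x <= npair x y.
  by apply/leP; exact: (Cantor.to_nat_non_decreasing x y).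
have h1 := h t.+1 (npair a b); have h2 := h a b.
have h3 : npair a b < npair t.+1 (npair a b).
  by apply: leq_trans h1; rewrite addnS ltnS leq_addr.
by split; apply: leq_ltn_trans h3; apply: leq_trans h2; rewrite ?leq_addl ?leq_addr.
Qed.

Lemma encodeK c : decode (encode c) = c.
Proof.
suff h fuel : encode c < fuel -> decode_fuel fuel (encode c) = c by exact: h.
elim: c fuel => [||||| a IHa b IHb | a IHa b IHb | a IHa b IHb | a IHa] [|fuel] //=;
  rewrite ltnS /npair !Cantor.cancel_of_to //= => lef.
- have [la lb] := npair_bounds 4 (encode a) (encode b).
  by rewrite IHa ?IHb //; [exact: leq_trans lb lef | exact: leq_trans la lef].
- have [la lb] := npair_bounds 5 (encode a) (encode b).
  by rewrite IHa ?IHb //; [exact: leq_trans lb lef | exact: leq_trans la lef].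
- have [la lb] := npair_bounds 6 (encode a) (encode b).
  by rewrite IHa ?IHb //; [exact: leq_trans lb lef | exact: leq_trans la lef].
- have [la _] := npair_bounds 7 (encode a) 0.
  by rewrite IHa //; exact: leq_trans la lef.
Qed.

(* [varphi g e] is the e-th partial function computable relative to g. *)
Definition varphi (g : nat -> nat) (e : nat) : pfun := eval g (decode e).

Definition computes (g h : nat -> nat) : Prop :=
  exists e, forall n, varphi g e n (h n).

Definition partial_computable (phi : pfun) : Prop :=
  exists e, phi = varphi (fun=> 0) e.

Definition char (X : set nat) (n : nat) : nat := nat_of_bool `[< X n >].

Definition computable (X : set nat) : Prop := computes (fun=> 0) (char X).

Definition ce (W : set nat) : Prop :=
  exists2 phi, partial_computable phi & W = pdom phi.

Definition jump (X : set nat) : set nat :=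
  [set e | pdom (varphi (char X) e) e].

Definition DNC2 (g f : nat -> nat) : Prop :=
  (forall e, f e = 0 \/ f e = 1) /\ (forall e v, varphi g e e v -> f e <> v).

Definition PA_degree (g f : nat -> nat) : Prop :=
  exists2 h, computes f h & DNC2 g h.

Definition almost_subset (X Y : set nat) : Prop := finite_set (X `\` Y).

Definition cohesive (C : set nat) : Prop :=
  infinite_set C /\
  forall W, ce W -> almost_subset C W \/ almost_subset C (~` W).

(* The domain is a subset of the ambient type T.  [is_structure] makes the
   relation live on the domain, so that [struct_set] below carries no junk. *)
Record structure (T : Type) := Structure {
  dom : set T;
  prec : T -> T -> Prop }.

Definition is_structure T (M : structure T) : Prop :=
  dom M !=set0 /\ forall x y, prec M x y -> dom M x /\ dom M y.

Definition linear_order T (M : structure T) : Prop :=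
  [/\ is_structure M,
      forall x, ~ prec M x x,
      forall x y z, prec M x y -> prec M y z -> prec M x z &
      forall x y, dom M x -> dom M y -> [\/ prec M x y, x = y | prec M y x]].

Definition isomorphic T U (M : structure T) (N : structure U) : Prop :=
  exists2 f : T -> U, set_bij (dom M) (dom N) f &
    forall x y, dom M x -> dom M y -> (prec M x y <-> prec N (f x) (f y)).

Definition presentation T (P : structure nat) (M : structure T) : Prop :=
  is_structure P /\ isomorphic P M.

(* The effective join of the domain (even numbers) and the relation (odd
   numbers). *)
Definition struct_set (P : structure nat) : set nat :=
  [set n | if odd n
           then prec P (Cantor.of_nat n./2).1 (Cantor.of_nat n./2).2
           else dom P n./2].

Definition power_fun (L : structure nat) (C : set nat) : set pfun :=
  [set phi | [/\ partial_computable phi,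
                 forall n m, phi n m -> dom L m &
                 almost_subset C (pdom phi)]].

Definition eqC (C : set nat) (phi psi : pfun) : Prop :=
  almost_subset C [set n | exists2 m, phi n m & psi n m].

Definition power_class (L : structure nat) (C : set nat) (phi : pfun) :
    set pfun :=
  [set psi | power_fun L C psi /\ eqC C phi psi].

Definition cohesive_power (L : structure nat) (C : set nat) :
    structure (set pfun) :=
  {| dom := power_class L C @` power_fun L C;
     prec E F := exists phi psi,
       [/\ power_fun L C phi, power_fun L C psi,
           E = power_class L C phi, F = power_class L C psi &
           almost_subset C
             [set n | exists a b, [/\ phi n a, psi n b & prec L a b]]] |}.

(* Main.v *)
Require Import Defs.
From mathcomp Require Import all_boot.
From mathcomp Require Import boolp classical_sets functions cardinality.
From mathcomp Require Import zify.
From Stdlib Require Cantor.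

Set Implicit Arguments.
Unset Strict Implicit.
Unset Printing Implicit Defensive.

(** The order is a sum of pieces, and the sizes of the finite maximal blocks of its
    cohesive powers separate the two halves of the diagonal relative to 0''.

    The relation [varphi (char 0'') n n v] has an exists-forall-exists definition
    with decidable matrix ([diag_matrixP]).  For each [n] this gives a race between
    the values 0 and 1, with a parameter [k] for the required precision.  If one of
    the values is true then, for all large [k], the race is won by it from a stage on
    that is computable from [k] ([evidence_settles]).  The parameter [k] also has
    finitely many events, namely halting times of programs on [k], so chosen that no
    partial computable function bounds them on an infinite set
    ([events_dominate]).  Every event makes one of two sides grow, according to the
    leader of the race.  Hence the growth of one side is computably bounded in [k]
    when its value is the true one ([grows_bounded]), while for no [n] are both
    sides bounded on infinitely many [k].

    A side of [n] at parameter [k] becomes a piece of the order: a tail of copies of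
    omega*, one for each time the side grows, followed by a core of finitely many
    elements whose number determines [n] and the side.  Only finitely many copies
    occur, so the core has an immediate predecessor in the order.  In a cohesive
    power the parameter [k] becomes a partial computable function on the cohesive
    set, and immediate successions are computed pointwise ([power_immediateP]).
    There the core retains an immediate predecessor only if the last copy can be
    found by a partial computable function.  Thus it is a maximal block if the growth
    is not computably bounded ([block_of_unbounded]), and if the growth is bounded,
    there is no maximal block of its size ([no_block_of_bounded]).

    So for every [n] at least one of two block sizes occurs in the power, and a size
    that occurs excludes one value of [varphi (char 0'') n n].  In a presentation [P]
    the occurrence of a maximal block of given size is an exists-forall-exists
    statement about [P], so P'' finds by search a size that occurs
    ([block_search]), and in this way computes a [DNC2] function relative to 0''.
    If [P] were computable, 0'' would compute that function, against diagonalization. *)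

(** * Pairing *)

Definition p1 (n : nat) : nat := (Cantor.of_nat n).1.
Definition p2 (n : nat) : nat := (Cantor.of_nat n).2.

Lemma p1_pair x y : p1 (npair x y) = x.
Proof. by rewrite /p1 /npair Cantor.cancel_of_to. Qed.

Lemma p2_pair x y : p2 (npair x y) = y.
Proof. by rewrite /p2 /npair Cantor.cancel_of_to. Qed.

Lemma pair_p n : npair (p1 n) (p2 n) = n.
Proof. by rewrite /npair /p1 /p2 -surjective_pairing Cantor.cancel_to_of. Qed.

Lemma of_natE n : Cantor.of_nat n = (p1 n, p2 n).
Proof. exact: surjective_pairing. Qed.

Definition pairK := (p1_pair, p2_pair).

Lemma npair_ge x y : x + y <= npair x y.
Proof. by have := Cantor.to_nat_non_decreasing x y; rewrite -/(npair x y); lia. Qed.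

Lemma p1_le n : p1 n <= n.
Proof. by have := npair_ge (p1 n) (p2 n); rewrite pair_p; lia. Qed.

Lemma p2_le n : p2 n <= n.
Proof. by have := npair_ge (p1 n) (p2 n); rewrite pair_p; lia. Qed.

Arguments npair : simpl never.
Arguments p1 : simpl never.
Arguments p2 : simpl never.
#[global] Opaque npair p1 p2.

Definition nth_code (F i : nat) : nat := p1 (iter i p2 F).

Lemma nth_code_le F i : nth_code F i <= F.
Proof.
apply: leq_trans (p1_le _) _; elim: i => //= i IH.
exact: leq_trans (p2_le _) IH.
Qed.

Lemma nth_code0 x F : nth_code (npair x F) 0 = x.
Proof. by rewrite /nth_code /= p1_pair. Qed.

Lemma nth_codeS x F i : nth_code (npair x F) i.+1 = nth_code F i.
Proof. by rewrite /nth_code iterSr p2_pair. Qed.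

(** Since [nth_code_le] bounds each coded entry by the code, [F] also serves
    as a common bound of the chosen witnesses. *)
Lemma finite_choice_code (Q : nat -> nat -> Prop) N :
  (forall i, i < N -> exists u, Q i u) ->
  exists F, forall i, i < N -> Q i (nth_code F i).
Proof.
elim: N Q => [|N IH] Q H; first by exists 0.
have [u0 Q0] := H 0 isT.
have [|F HF] := IH (fun i => Q i.+1); first by move=> i lt; exact: H.
exists (npair u0 F) => -[|i] lt; first by rewrite nth_code0.
by rewrite nth_codeS; exact: HF.
Qed.

(** * Computable functions *)

Lemma computesP g f : computes g f <-> exists c, forall n, eval g c n (f n).
Proof.
split=> [[e H]|[c H]]; first by exists (decode e).
by exists (encode c) => n; rewrite /varphi encodeK.
Qed.

Lemma eq_computes g f f' : f =1 f' -> computes g f -> computes g f'.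
Proof. by move=> E [e H]; exists e => n; rewrite -E. Qed.

Lemma computes_comp g f h :
  computes g f -> computes g h -> computes g (fun z => f (h z)).
Proof.
move=> /computesP[c Hc] /computesP[d Hd]; apply/computesP.
by exists (CComp c d) => n; exists (h n).
Qed.

Lemma computes_pair g f h :
  computes g f -> computes g h -> computes g (fun z => npair (f z) (h z)).
Proof.
move=> /computesP[c Hc] /computesP[d Hd]; apply/computesP.
by exists (CPair c d) => n; exists (f n), (h n).
Qed.

Lemma computes_id g : computes g (fun z => z).
Proof.
apply/computesP; exists (CPair CLeft CRight) => n.
by exists (p1 n), (p2 n); rewrite pair_p.
Qed.

Fixpoint const_code (k : nat) : code :=
  if k is k'.+1 then CComp CSucc (const_code k') else CZero.

Lemma eval_const g k n m : eval g (const_code k) n m <-> m = k.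
Proof.
elim: k m => [|k IH] m //=; split=> [[x /IH -> ->] //|->].
by exists k => //; apply/IH.
Qed.

Lemma computes_const g k : computes g (fun=> k).
Proof. by apply/computesP; exists (const_code k) => n; apply/eval_const. Qed.

Lemma computes_p1 g f : computes g f -> computes g (fun z => p1 (f z)).
Proof. by apply: computes_comp; apply/computesP; exists CLeft. Qed.

Lemma computes_p2 g f : computes g f -> computes g (fun z => p2 (f z)).
Proof. by apply: computes_comp; apply/computesP; exists CRight. Qed.

Lemma computes_succ g f : computes g f -> computes g (fun z => (f z).+1).
Proof. by apply: (computes_comp (f := succn)); apply/computesP; exists CSucc. Qed.

Lemma computes_oracle g f : computes g f -> computes g (fun z => g (f z)).
Proof. by apply: computes_comp; apply/computesP; exists COracle. Qed.

Lemma computes_iteri g k b a :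
  computes g k -> computes g (fun w => b (p1 w) (p1 (p2 w)) (p2 (p2 w))) ->
  computes g a -> computes g (fun z => iteri (k z) (b z) (a z)).
Proof.
move=> ck /computesP[d Hd] /computesP[c Hc].
have : computes g (fun w => iteri (p2 w) (b (p1 w)) (a (p1 w))).
  apply/computesP; exists (CPrec c d) => n.
  change (prim_rec (eval g c) (eval g d) (p1 n) (p2 n)
            (iteri (p2 n) (b (p1 n)) (a (p1 n)))).
  elim: (p2 n) => [|j IH] /=; first exact: Hc.
  exists (iteri j (b (p1 n)) (a (p1 n))) => //.
  by have := Hd (npair (p1 n) (npair j (iteri j (b (p1 n)) (a (p1 n)))));
    rewrite !pairK.
move=> /computes_comp/(_ (computes_pair (computes_id g) ck)).
by apply: eq_computes => z; rewrite !pairK.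
Qed.

(** A boolean function is computed as a function to 0 and 1. *)
Notation decides g b := (computes g (fun z => nat_of_bool (b z))).

Create HintDb comput discriminated.
#[global] Hint Resolve computes_id computes_const computes_pair computes_p1
  computes_p2 computes_succ computes_oracle : comput.
#[global] Hint Extern 3 (computes _ (fun z => iteri _ _ _)) =>
  (apply: computes_iteri; cbv beta) : comput.

Ltac comput := cbv beta zeta; auto 100 with comput nocore.

Lemma computes_iter g k f a :
  computes g k -> computes g f -> computes g a ->
  computes g (fun z => iter (k z) f (a z)).
Proof.
move=> ck cf ca.
have : computes g (fun z => iteri (k z) (fun _ => f) (a z)).
  by apply: computes_iteri => //; apply: (computes_comp cf); comput.
apply: eq_computes => z; by elim: (k z) => //= j ->.
Qed.

Lemma computes_nth_code g F i :
  computes g F -> computes g i -> computes g (fun z => nth_code (F z) (i z)).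
Proof.
move=> cF ci; apply: computes_p1; apply: computes_iter => //; comput.
Qed.

Lemma computes_pred g f : computes g f -> computes g (fun z => (f z).-1).
Proof.
move=> cf; have : computes g (fun z => iteri (f z) (fun i _ => i) 0) by comput.
by apply: eq_computes => z; case: (f z).
Qed.
#[global] Hint Resolve computes_nth_code computes_pred : comput.

Lemma computes_add g f h :
  computes g f -> computes g h -> computes g (fun z => f z + h z).
Proof.
move=> cf ch.
have : computes g (fun z => iteri (h z) (fun _ => succn) (f z)) by comput.
by apply: eq_computes => z; elim: (h z) => [|j /= ->]; rewrite ?addn0 ?addnS.
Qed.

Lemma computes_sub g f h :
  computes g f -> computes g h -> computes g (fun z => f z - h z).
Proof.
move=> cf ch.
have : computes g (fun z => iteri (h z) (fun _ => predn) (f z)) by comput.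
by apply: eq_computes => z; elim: (h z) => [|j /= ->]; rewrite ?subn0 ?subnS.
Qed.
#[global] Hint Resolve computes_add computes_sub : comput.

Lemma computes_if g b f h :
  decides g b -> computes g f -> computes g h ->
  computes g (fun z => if b z then f z else h z).
Proof.
move=> cb cf ch.
have : computes g (fun z => iteri (b z) (fun _ _ => f z) (h z)).
  by apply: computes_iteri => //; apply: (computes_comp cf); comput.
by apply: eq_computes => z; case: (b z).
Qed.

Lemma decides_eq0 g f : computes g f -> decides g (fun z => f z == 0).
Proof.
move=> cf; have : computes g (fun z => iteri (f z) (fun _ _ => 0) 1) by comput.
by apply: eq_computes => z; case: (f z).
Qed.

Lemma decides_neg g b : decides g b -> decides g (fun z => ~~ b z).
Proof. by move/decides_eq0; apply: eq_computes => z; case: (b z). Qed.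

Lemma decides_and g b c :
  decides g b -> decides g c -> decides g (fun z => b z && c z).
Proof.
move=> cb /(computes_if cb)/(_ (computes_const g 0)).
by apply: eq_computes => z; case: (b z).
Qed.

Lemma decides_or g b c :
  decides g b -> decides g c -> decides g (fun z => b z || c z).
Proof.
move=> cb /(computes_if cb (computes_const g 1)).
by apply: eq_computes => z; case: (b z).
Qed.

Lemma decides_imp g b c :
  decides g b -> decides g c -> decides g (fun z => b z ==> c z).
Proof.
move=> /decides_neg cb /(decides_or cb).
by apply: eq_computes => z; case: (b z).
Qed.

Lemma decides_leq g f h :
  computes g f -> computes g h -> decides g (fun z => f z <= h z).
Proof. by move=> cf ch; apply: decides_eq0; comput. Qed.

Lemma decides_if g b c d :
  decides g b -> decides g c -> decides g d ->
  decides g (fun z => if b z then c z else d z).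
Proof.
move=> cb cc /(computes_if cb cc).
by apply: eq_computes => z; case: (b z).
Qed.
#[global] Hint Resolve computes_if decides_if decides_neg decides_and decides_or decides_imp
  decides_leq : comput.

Lemma decides_eqn g f h :
  computes g f -> computes g h -> decides g (fun z => f z == h z).
Proof.
move=> cf ch.
have : decides g (fun z => (f z <= h z) && (h z <= f z)) by comput.
by apply: eq_computes => z; rewrite eqn_leq.
Qed.
#[global] Hint Resolve decides_eqn : comput.

Lemma decides_eqb g b c :
  decides g b -> decides g c -> decides g (fun z => b z == c z).
Proof.
move=> cb cc; have := decides_eqn cb cc.
by apply: eq_computes => z; case: (b z); case: (c z).
Qed.
#[global] Hint Resolve decides_eqb : comput.

Lemma computes_double g f : computes g f -> computes g (fun z => (f z).*2).
Proof.
move=> cf; have : computes g (fun z => f z + f z) by comput.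
by apply: eq_computes => z; rewrite addnn.
Qed.

Lemma decides_odd g f : computes g f -> decides g (fun z => odd (f z)).
Proof.
move=> cf.
have : computes g (fun z => iteri (f z) (fun _ r => nat_of_bool (r == 0)) 0) by comput.
by apply: eq_computes => z; elim: (f z) => //= j ->; case: (odd j).
Qed.
#[global] Hint Resolve computes_double decides_odd : comput.

Lemma computes_half g f : computes g f -> computes g (fun z => (f z)./2).
Proof.
move=> cf.
have : computes g (fun z => iteri (f z) (fun i r => odd i + r) 0) by comput.
by apply: eq_computes => z; elim: (f z) => //= j ->; rewrite uphalf_half.
Qed.

Lemma computes_max g f h :
  computes g f -> computes g h -> computes g (fun z => maxn (f z) (h z)).
Proof. by move=> cf ch; rewrite /maxn; comput. Qed.
#[global] Hint Resolve computes_half computes_max : comput.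

(** Bounded quantifiers. Unlike unbounded ones, they preserve decidability. *)
Definition ball (k : nat) (P : nat -> bool) : bool := all P (iota 0 k).
Definition bex (k : nat) (P : nat -> bool) : bool := has P (iota 0 k).

Lemma ballP k (P : nat -> bool) : reflect (forall i, i < k -> P i) (ball k P).
Proof.
apply: (iffP allP) => H i; last by rewrite mem_iota => ?; apply: H.
by move=> lt; apply: H; rewrite mem_iota.
Qed.

Lemma bexP k (P : nat -> bool) : reflect (exists2 i, i < k & P i) (bex k P).
Proof.
by apply: (iffP hasP) => -[i H Pi]; exists i => //; move: H; rewrite mem_iota.
Qed.

Lemma decides_ball g k (P : nat -> nat -> bool) :
  computes g k -> decides g (fun w => P (p1 w) (p2 w)) ->
  decides g (fun z => ball (k z) (P z)).
Proof.
move=> ck cP.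
have : computes g (fun z =>
    iteri (k z) (fun i r => nat_of_bool ((r == 1) && P z i)) 1).
  apply: computes_iteri; [comput| |comput]; apply: decides_and; first comput.
  have := computes_comp cP (h := fun w => npair (p1 w) (p1 (p2 w))).
  by move=> /(_ ltac:(comput)); apply: eq_computes => w; rewrite !pairK.
apply: eq_computes => z; elim: (k z) => // j IH; rewrite [LHS]/= IH.
by rewrite /ball -(addn1 j) iotaD all_cat /= andbT add0n; case: (all _ _).
Qed.

Lemma decides_bex g k (P : nat -> nat -> bool) :
  computes g k -> decides g (fun w => P (p1 w) (p2 w)) ->
  decides g (fun z => bex (k z) (P z)).
Proof.
move=> ck cP.
have : decides g (fun z => ~~ ball (k z) (fun i => ~~ P z i)).
  by apply: decides_neg; apply: decides_ball; comput.
by apply: eq_computes => z; rewrite /ball /bex all_predC negbK.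
Qed.
#[global] Hint Extern 3 (computes _ (fun z => nat_of_bool (ball _ _))) =>
  (apply: decides_ball; cbv beta) : comput.
#[global] Hint Extern 3 (computes _ (fun z => nat_of_bool (bex _ _))) =>
  (apply: decides_bex; cbv beta) : comput.

Lemma decides_comp2 g (b : nat -> nat -> bool) f h :
  decides g (fun w => b (p1 w) (p2 w)) -> computes g f -> computes g h ->
  decides g (fun z => b (f z) (h z)).
Proof.
move=> cb cf ch; have := computes_comp cb (computes_pair cf ch).
by apply: eq_computes => z; rewrite !pairK.
Qed.

Lemma eval_mu g c (b : nat -> nat -> bool) :
  (forall w, eval g c w (~~ b (p1 w) (p2 w))) ->
  forall z k, eval g (CMu c) z k <-> b z k /\ forall j, j < k -> ~~ b z j.
Proof.
move=> Hc z k; have Hw j : eval g c (npair z j) (~~ b z j).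
  by have := Hc (npair z j); rewrite !pairK.
split=> -[H0 Hlt]; split.
- by have := eval_functional (Hw k) H0; case: (b z k).
- move=> j /Hlt[i Hi]; have := eval_functional (Hw j) Hi; by case: (b z j).
- by have := Hw k; rewrite H0.
- by move=> j /Hlt nb; exists 0; have := Hw j; rewrite nb.
Qed.

Lemma computes_min g (b : nat -> nat -> bool) :
  decides g (fun w => b (p1 w) (p2 w)) -> (forall z, exists x, b z x) ->
  exists2 f, computes g f & forall z, b z (f z).
Proof.
move=> /decides_neg/computesP[c /eval_mu Hc] ex.
exists (fun z => ex_minn (ex z)); last by move=> z; case: ex_minnP.
apply/computesP; exists (CMu c) => z; apply/Hc.
case: ex_minnP => m bm le; split=> // j lt; apply/negP => /le; lia.
Qed.

(** Transitivity of relative computability is a substitution of programs: every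
    oracle call is replaced by the program that answers it. *)
Fixpoint subst_oracle (a c : code) : code :=
  match c with
  | COracle => a
  | CPair x y => CPair (subst_oracle a x) (subst_oracle a y)
  | CComp x y => CComp (subst_oracle a x) (subst_oracle a y)
  | CPrec x y => CPrec (subst_oracle a x) (subst_oracle a y)
  | CMu x => CMu (subst_oracle a x)
  | c => c
  end.

Lemma eval_subst_oracle g h a c :
  (forall n, eval g a n (h n)) -> eval g (subst_oracle a c) = eval h c.
Proof.
move=> Ha; elim: c => //= [|x -> y ->|x -> y ->|x -> y ->|x ->] //.
apply/funext => n; apply/funext => m; apply/propext.
by split=> [/eval_functional/(_ (Ha n))|->].
Qed.

Lemma computes_trans g h f : computes g h -> computes h f -> computes g f.
Proof.
move=> /computesP[a Ha] /computesP[c Hc]; apply/computesP.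
by exists (subst_oracle a c) => n; rewrite (eval_subst_oracle _ Ha).
Qed.

(** * Coded derivations *)

(** The components of a code number [<tag, <sub1, sub2>>] and of a fact
    [<code number, <argument, value>>]. *)
Notation sub1 e := (p1 (p2 e)).
Notation sub2 e := (p2 (p2 e)).
Notation arg f := (p1 (p2 f)).
Notation value f := (p2 (p2 f)).

Definition fact (e n m : nat) : nat := npair e (npair n m).

Lemma decodeE e : decode e =
  match p1 e with
  | 0 => CZero
  | 1 => CSucc
  | 2 => CLeft
  | 3 => CRight
  | 4 => COracle
  | 5 => CPair (decode (sub1 e)) (decode (sub2 e))
  | 6 => CComp (decode (sub1 e)) (decode (sub2 e))
  | 7 => CPrec (decode (sub1 e)) (decode (sub2 e))
  | _ => CMu (decode (sub1 e))
  end.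
Proof.
have sub_lt e' : 0 < p1 e' -> sub1 e' < e' /\ sub2 e' < e'.
  move=> t; have := npair_ge (p1 e') (p2 e'); rewrite pair_p.
  have := npair_ge (sub1 e') (sub2 e'); rewrite pair_p; lia.
have fuel_irr k k' e' : e' < k -> e' < k' -> decode_fuel k e' = decode_fuel k' e'.
  elim/ltn_ind: e' k k' => e' IH [|k] [|k'] //= lk lk'.
  have := sub_lt e'; rewrite !of_natE.
  move: (p1 _) (p1 (p2 _)) (p2 (p2 _)) => [|t] a b // /(_ isT)[la lb].
  have Ea : decode_fuel k a = decode_fuel k' a by apply: IH => //; lia.
  have Eb : decode_fuel k b = decode_fuel k' b by apply: IH => //; lia.
  by rewrite Ea Eb.
rewrite {1}/decode /=; have := sub_lt e; rewrite !of_natE.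
move: (p1 _) (p1 (p2 _)) (p2 (p2 _)) => [|t] a b // /(_ isT)[la lb].
have Ea : decode_fuel e a = decode a by apply: fuel_irr; lia.
have Eb : decode_fuel e b = decode b by apply: fuel_irr; lia.
by rewrite Ea Eb.
Qed.

(** One step of an evaluation: the fact [e n m] follows from the facts in [K],
    whatever the oracle; oracle calls are constrained separately. *)
Definition rule (K : nat -> nat -> nat -> Prop) (e n m : nat) : Prop :=
  match p1 e with
  | 0 => m = 0
  | 1 => m = n.+1
  | 2 => m = p1 n
  | 3 => m = p2 n
  | 4 => True
  | 5 => K (sub1 e) n (p1 m) /\ K (sub2 e) n (p2 m)
  | 6 => exists x, K (sub2 e) n x /\ K (sub1 e) x m
  | 7 => if p2 n is k.+1
         then exists r, K e (npair (p1 n) k) r /\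
                        K (sub2 e) (npair (p1 n) (npair k r)) m
         else K (sub1 e) (p1 n) m
  | _ => K (sub1 e) (npair n m) 0 /\
         forall j, j < m -> exists v, K (sub1 e) (npair n j) v.+1
  end.

Lemma rule_mono (K K' : nat -> nat -> nat -> Prop) e n m :
  (forall e n m, K e n m -> K' e n m) -> rule K e n m -> rule K' e n m.
Proof.
move=> KK'; rewrite /rule; case: (p1 e) => [|[|[|[|[|[|[|[|t]]]]]]]] //.
- by move=> [/KK' ? /KK' ?].
- by move=> [x [/KK' ? /KK' ?]]; exists x.
- case: (p2 n) => [/KK'//|k [r [/KK' ? /KK' ?]]]; by exists r.
- move=> [/KK' ? H]; split=> // j /H[v /KK' ?]; by exists v.
Qed.

(** The equations that characterize evaluation; soundness and completeness of
    derivations both follow from them. *)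
Lemma eval_rule g e n m :
  eval g (decode e) n m <->
  rule (fun e n m => eval g (decode e) n m) e n m /\ (p1 e = 4 -> m = g n).
Proof.
rewrite {1}decodeE /rule.
case E: (p1 e) => [|[|[|[|[|[|[|[|t]]]]]]]].
- by split=> [H|[]].
- by split=> [H|[]].
- by split=> [H|[]].
- by split=> [H|[]].
- by split=> [H|[_ /(_ erefl)]].
- split=> [[x [y [Hx Hy ->]]]|[[Hx Hy] _]]; first by rewrite !pairK.
  by exists (p1 m), (p2 m); rewrite pair_p.
- split=> [[x Hb Ha]|[[x [Hb Ha]] _]]; last by exists x.
  by split=> //; exists x.
- change (eval g _ n m) with (prim_rec (eval g (decode (sub1 e)))
    (eval g (decode (sub2 e))) (p1 n) (p2 n) m).
  case: (p2 n) => [|k] /=; first by split=> [|[]].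
  have Er r : eval g (decode e) (npair (p1 n) k) r <->
      prim_rec (eval g (decode (sub1 e))) (eval g (decode (sub2 e))) (p1 n) k r.
    rewrite (decodeE e) E.
    change (eval g _ (npair (p1 n) k) r) with (prim_rec (eval g (decode (sub1 e)))
      (eval g (decode (sub2 e))) (p1 (npair (p1 n) k)) (p2 (npair (p1 n) k)) r).
    by rewrite !pairK.
  split=> [[r /Er Hr Hm]|[[r [/Er Hr Hm]] _]]; last by exists r.
  by split=> //; exists r.
- by split=> [[H0 Hj]|[[H0 Hj] _]]; split.
Qed.

(** A derivation records the oracle answers without checking them, so that being
    a derivation depends on no oracle; [truthful] compares the answers with [g]. *)
Definition in_seq (s : seq nat) (e n m : nat) : Prop := fact e n m \in s.

Definition rule_fact (K : nat -> nat -> nat -> Prop) (f : nat) : Prop :=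
  rule K (p1 f) (arg f) (value f).

Definition derivation (s : seq nat) : Prop :=
  forall i, i < size s -> rule_fact (in_seq (take i s)) (nth 0 s i).

Definition truthful (g : nat -> nat) (s : seq nat) : Prop :=
  forall f, f \in s -> p1 (p1 f) = 4 -> value f = g (arg f).

Definition provable g e n m : Prop :=
  exists s, [/\ derivation s, truthful g s & in_seq s e n m].

Lemma derivation_cat s t : derivation s -> derivation t -> derivation (s ++ t).
Proof.
move=> ds dt i; rewrite size_cat nth_cat take_cat => lt.
case: (ltnP i (size s)) => [lts|le]; first exact: (ds i lts).
have /dt : i - size s < size t by lia.
by apply: rule_mono => e n m; rewrite /in_seq mem_cat => ->; rewrite orbT.
Qed.

Lemma truthful_cat g s t : truthful g s -> truthful g t -> truthful g (s ++ t).
Proof. by move=> ts tt f; rewrite mem_cat => /orP[/ts|/tt]. Qed.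

Lemma derivation_rcons s f :
  derivation s -> rule_fact (in_seq s) f -> derivation (rcons s f).
Proof.
move=> ds rf i; rewrite size_rcons nth_rcons ltnS -cats1 take_cat => les.
case: (ltngtP i (size s)) les => // [lt _|-> _]; first exact: (ds i lt).
by rewrite subnn take0 cats0.
Qed.

(** A rule uses finitely many facts, so their derivations can be joined. *)
Lemma provable_rule g e n m :
  rule (provable g) e n m -> (p1 e = 4 -> m = g n) -> provable g e n m.
Proof.
move=> R ora.
suff [s [ds ts Rs]] : exists s, [/\ derivation s, truthful g s &
    rule (in_seq s) e n m].
  exists (rcons s (fact e n m)); split.
  - by apply: derivation_rcons; rewrite // /rule_fact /fact !pairK.
  - move=> f; rewrite mem_rcons inE => /orP[/eqP ->|/ts //].
    by rewrite /fact !pairK.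
  - by rewrite /in_seq mem_rcons mem_head.
have two e1 n1 m1 e2 n2 m2 : provable g e1 n1 m1 -> provable g e2 n2 m2 ->
    exists s, [/\ derivation s, truthful g s, in_seq s e1 n1 m1 &
                  in_seq s e2 n2 m2].
  move=> [s [ds ts is']] [t [dt tt it]]; exists (s ++ t).
  split; [exact: derivation_cat|exact: truthful_cat| |];
    by rewrite /in_seq mem_cat ?is' // it orbT.
have nil : exists s, derivation s /\ truthful g s by exists [::].
move: R; rewrite /rule; case: (p1 e) => [|[|[|[|[|[|[|[|t]]]]]]]].
- by move=> ->; have [s []] := nil; exists s.
- by move=> ->; have [s []] := nil; exists s.
- by move=> ->; have [s []] := nil; exists s.
- by move=> ->; have [s []] := nil; exists s.
- by move=> _; have [s []] := nil; exists s.
- by move=> [/two H /H[s []]]; exists s.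
- by move=> [x [/two H /H[s []]]]; exists s; split=> //; exists x.
- case: (p2 n) => [|k]; first by move=> [s []]; exists s.
  by move=> [r [/two H /H[s []]]]; exists s; split=> //; exists r.
- move=> [[s [ds ts is']] H].
  suff [u [du tu iu]] : exists u, [/\ derivation u, truthful g u &
      forall j, j < m -> exists v, in_seq u (sub1 e) (npair n j) v.+1].
    exists (s ++ u); split; [exact: derivation_cat|exact: truthful_cat|].
    split=> [|j /iu[v iv]]; first by rewrite /in_seq mem_cat is'.
    by exists v; rewrite /in_seq mem_cat iv orbT.
  elim: m H {ds ts is' ora} => [_|m IH H]; first by exists [::].
  have [|u [du tu iu]] := IH; first by move=> j lt; apply: H; lia.
  have [v [w [dw tw iw]]] := H m (ltnSn m).
  exists (u ++ w); split; [exact: derivation_cat|exact: truthful_cat|].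
  move=> j; rewrite ltnS leq_eqVlt => /orP[/eqP ->|/iu[v' iv]].
    by exists v; rewrite /in_seq mem_cat iw orbT.
  by exists v'; rewrite /in_seq mem_cat iv.
Qed.

Lemma provable_eval g e n m : eval g (decode e) n m -> provable g e n m.
Proof.
elim/ltn_ind: e n m => e IH n m.
have sub_lt : 0 < p1 e -> sub1 e < e /\ sub2 e < e.
  move=> t; have := npair_ge (p1 e) (p2 e); rewrite pair_p.
  have := npair_ge (sub1 e) (sub2 e); rewrite pair_p; lia.
(* Primitive recursion refers to the same program at a smaller counter. *)
move: {2}(p2 n) (leqnn (p2 n)) => k; elim: k n m => [|k IHk] n m lek
  /eval_rule[R ora]; apply: provable_rule => //; move: R; rewrite /rule;
  case E: (p1 e) => [|[|[|[|[|[|[|[|t]]]]]]]] //;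
  have [la lb] := sub_lt (ltac:(by rewrite E)).
- by move=> [/(IH _ la) ? /(IH _ lb)].
- by move=> [x [/(IH _ lb) ? /(IH _ la)]]; exists x.
- by case: (p2 n) lek => // _ /(IH _ la).
- by move=> [/(IH _ la) ? H]; split=> // j /H[v /(IH _ la)]; exists v.
- by move=> [/(IH _ la) ? /(IH _ lb)].
- by move=> [x [/(IH _ lb) ? /(IH _ la)]]; exists x.
- case: (p2 n) lek => [_ /(IH _ la) //|j lej [r [Hr /(IH _ lb) Hb]]].
  exists r; split=> //; apply: IHk Hr; rewrite p2_pair; lia.
- by move=> [/(IH _ la) ? H]; split=> // j /H[v /(IH _ la)]; exists v.
Qed.

(** A derivation is coded by the pair of its length and a coded sequence of facts. *)
Definition nth_fact (D i : nat) : nat := nth_code (p2 D) i.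

Definition among (D i e n m : nat) : bool :=
  bex i (fun j => nth_fact D j == fact e n m).

Definition justified (D i : nat) : bool :=
  let f := nth_fact D i in let e := p1 f in let n := arg f in let m := value f in
  if p1 e == 0 then m == 0 else
  if p1 e == 1 then m == n.+1 else
  if p1 e == 2 then m == p1 n else
  if p1 e == 3 then m == p2 n else
  if p1 e == 4 then true else
  if p1 e == 5 then among D i (sub1 e) n (p1 m) && among D i (sub2 e) n (p2 m) else
  if p1 e == 6 then
    bex i (fun j => let x := value (nth_fact D j) in
      (nth_fact D j == fact (sub2 e) n x) && among D i (sub1 e) x m) else
  if p1 e == 7 then
    if p2 n == 0 then among D i (sub1 e) (p1 n) m else
    bex i (fun j => let r := value (nth_fact D j) in
      (nth_fact D j == fact e (npair (p1 n) (p2 n).-1) r) &&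
      among D i (sub2 e) (npair (p1 n) (npair (p2 n).-1 r)) m)
  else
    among D i (sub1 e) (npair n m) 0 &&
    ball m (fun j => bex i (fun l => let v := value (nth_fact D l) in
      (0 < v) && (nth_fact D l == fact (sub1 e) (npair n j) v))).

Definition valid (D : nat) : bool := ball (p1 D) (justified D).

Definition is_query (D i : nat) : bool := p1 (p1 (nth_fact D i)) == 4.
Definition query (D i : nat) : nat := arg (nth_fact D i).
Definition answer (D i : nat) : nat := value (nth_fact D i).
Definition concludes (D e n m : nat) : bool := among D (p1 D) e n m.

Lemma among_value D i e n (P : nat -> bool) :
  (exists x, among D i e n x /\ P x) <->
  bex i (fun j => (nth_fact D j == fact e n (value (nth_fact D j))) &&
                  P (value (nth_fact D j))).
Proof.
split=> [[x [/bexP[j lt /eqP E] Px]]|/bexP[j lt /andP[E Pj]]].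
  by apply/bexP; exists j; rewrite // E /fact !pairK eqxx.
by exists (value (nth_fact D j)); split=> //; apply/bexP; exists j.
Qed.

Lemma justifiedP D i : justified D i <-> rule_fact (among D i) (nth_fact D i).
Proof.
rewrite /justified /rule_fact /rule; move: (nth_fact D i) => f.
have eqn (x y : nat) : x == y <-> x = y by split=> /eqP.
case: (p1 (p1 f)) => [|[|[|[|[|[|[|[|t]]]]]]]] //=.
- by split=> /andP.
- by symmetry; apply: (among_value D i _ _ (fun x => among D i _ x _)).
- case: (p2 (arg f)) => [|k] //=; symmetry.
  by apply: (among_value D i _ _ (fun r => among D i _ (npair _ (npair k r)) _)).
- split=> [/andP[H0 /ballP H]|[H0 H]].
    split=> // j /H/bexP[l lt /andP[]].
    case: (value _) => // v _ E; by exists v; apply/bexP; exists l.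
  apply/andP; split=> //; apply/ballP => j /H[v /bexP[l lt /eqP E]].
  by apply/bexP; exists l; rewrite // E /fact !pairK eqxx.
Qed.

Lemma nth_code_foldr s i : i < size s -> nth_code (foldr npair 0 s) i = nth 0 s i.
Proof. by elim: s i => //= f s IH [|i] lt; rewrite ?nth_code0 ?nth_codeS ?IH. Qed.

(** Kleene's normal form.  The oracle occurs only in the last clause, so a
    definition of the oracle can be substituted there. *)
Lemma evalP g e n m : eval g (decode e) n m <->
  exists D, [/\ valid D, concludes D e n m &
    forall i, i < p1 D -> is_query D i -> answer D i = g (query D i)].
Proof.
split=> [/provable_eval[s [ds ts is']]|[D [/ballP vD /bexP[i lt /eqP Ei] ora]]].
  exists (npair (size s) (foldr npair 0 s)).
  have nthE i : i < size s ->
      nth_fact (npair (size s) (foldr npair 0 s)) i = nth 0 s i.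
    by move=> lt; rewrite /nth_fact p2_pair nth_code_foldr.
  have amongE i e' n' m' : i <= size s -> in_seq (take i s) e' n' m' ->
      among (npair (size s) (foldr npair 0 s)) i e' n' m'.
    move=> le; rewrite /in_seq => /(nthP 0)[j].
    rewrite size_takel // => lt; rewrite nth_take // => E.
    by apply/bexP; exists j; rewrite // nthE ?E //; lia.
  split.
  - apply/ballP => i; rewrite p1_pair => lt; apply/justifiedP; rewrite nthE //.
    by apply: rule_mono (ds i lt) => e' n' m'; apply: amongE; lia.
  - by apply: amongE; rewrite p1_pair // take_size.
  - move=> i; rewrite p1_pair => lt; rewrite /is_query /answer /query nthE //.
    by move=> /eqP; apply: ts; rewrite mem_nth.
suff sound j : j < p1 D ->
    eval g (decode (p1 (nth_fact D j))) (arg (nth_fact D j)) (value (nth_fact D j)).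
  by have := sound i lt; rewrite Ei /fact !pairK.
elim/ltn_ind: j => j IH lej; apply/eval_rule; split; last first.
  by move=> E; apply: ora => //; rewrite /is_query E.
have /justifiedP := vD j lej; apply: rule_mono => e' n' m' /bexP[l ltl /eqP El].
by have := IH l ltl; rewrite El /fact !pairK; apply; lia.
Qed.

(** For this reason halting times dominate the computed values. *)
Lemma concludes_le D e n m : concludes D e n m -> m <= D.
Proof.
move=> /bexP[i _ /eqP E]; have := nth_code_le (p2 D) i.
rewrite -/(nth_fact D i) E /fact.
have := npair_ge e (npair n m); have := npair_ge n m; have := p2_le D; lia.
Qed.

Lemma computes_fact g e n m : computes g e -> computes g n -> computes g m ->
  computes g (fun z => fact (e z) (n z) (m z)).
Proof. by move=> *; rewrite /fact; comput. Qed.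

Lemma computes_nth_fact g D i : computes g D -> computes g i ->
  computes g (fun z => nth_fact (D z) (i z)).
Proof. by move=> *; rewrite /nth_fact; comput. Qed.
#[global] Hint Resolve computes_fact computes_nth_fact : comput.

Lemma decides_among g D i e n m : computes g D -> computes g i ->
  computes g e -> computes g n -> computes g m ->
  decides g (fun z => among (D z) (i z) (e z) (n z) (m z)).
Proof.
move=> cD ci ce cn cm; rewrite /among; apply: decides_bex => //.
have lift f : computes g f -> computes g (fun w => f (p1 w)).
  by move=> cf; apply: (computes_comp cf); comput.
by apply: decides_eqn; apply: computes_nth_fact || apply: computes_fact;
  try apply: lift; comput.
Qed.
#[global] Hint Resolve decides_among : comput.

Lemma decides_valid g D : computes g D -> decides g (fun z => valid (D z)).
Proof.
apply: (computes_comp (f := fun D => nat_of_bool (valid D))).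
by rewrite /valid /justified; comput.
Qed.

Lemma decides_is_query g D i : computes g D -> computes g i ->
  decides g (fun z => is_query (D z) (i z)).
Proof. by move=> *; rewrite /is_query; comput. Qed.

Lemma computes_query g D i : computes g D -> computes g i ->
  computes g (fun z => query (D z) (i z)).
Proof. by move=> *; rewrite /query; comput. Qed.

Lemma computes_answer g D i : computes g D -> computes g i ->
  computes g (fun z => answer (D z) (i z)).
Proof. by move=> *; rewrite /answer; comput. Qed.

Lemma decides_concludes g D e n m : computes g D -> computes g e ->
  computes g n -> computes g m ->
  decides g (fun z => concludes (D z) (e z) (n z) (m z)).
Proof. by move=> *; rewrite /concludes; comput. Qed.
#[global] Hint Resolve decides_valid decides_is_query computes_query
  computes_answer decides_concludes : comput.

(* Under a bounded quantifier the parameters occur composed with projections. *)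
#[global] Hint Extern 4 (computes ?g _) =>
  (match goal with H : computes g ?f |- _ => apply: (computes_comp (f := f) H) end)
  : comput.

(** * The jump *)

Definition halts (g : nat -> nat) (e n D : nat) : bool :=
  [&& valid D, bex (p1 D) (fun i => nth_fact D i == fact e n (answer D i)) &
      ball (p1 D) (fun i => is_query D i ==> (answer D i == g (query D i)))].

Lemma haltsE g e n D :
  halts g e n D <-> exists m, [/\ valid D, concludes D e n m &
    forall i, i < p1 D -> is_query D i -> answer D i = g (query D i)].
Proof.
split=> [/and3P[vD /bexP[i lt E] /ballP ora]|[m [vD cD ora]]].
  exists (answer D i); split=> //; first by apply/bexP; exists i.
  by move=> j ltj qj; have := ora j ltj; rewrite qj => /eqP.
apply/and3P; split=> //.
  have /bexP[i lt /eqP E] := cD; apply/bexP; exists i => //.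
  by rewrite E /answer E /fact !pairK.
by apply/ballP => i lt; apply/implyP => qi; rewrite ora.
Qed.

Lemma haltsP g e n : pdom (varphi g e) n <-> exists D, halts g e n D.
Proof.
split=> [[m /evalP[D H]]|[D /haltsE[m H]]]; first by exists D; apply/haltsE; exists m.
by exists m; apply/evalP; exists D.
Qed.

Lemma halts_value g e n m D : varphi g e n m -> halts g e n D -> m <= D.
Proof.
move=> em /haltsE[m' H].
have em' : eval g (decode e) n m' by apply/evalP; exists D.
rewrite (eval_functional em em'); case: H => _ /concludes_le //.
Qed.

Lemma decides_halts g g' e n D : computes g g' -> computes g e ->
  computes g n -> computes g D -> decides g (fun z => halts g' (e z) (n z) (D z)).
Proof. by move=> cg ce cn cD; rewrite /halts; comput. Qed.
#[global] Hint Resolve decides_halts : comput.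

Lemma computes_encode_const g f : computes g f ->
  computes g (fun z => encode (const_code (f z))).
Proof.
move=> cf.
have : computes g (fun z =>
    iteri (f z) (fun _ r => npair 6 (npair (encode CSucc) r)) (encode CZero)).
  by comput.
by apply: eq_computes => z; elim: (f z) => //= j ->.
Qed.

(** Completeness of the jump: the program searching for [z] with [R w z] is
    obtained from [w] by plugging in the constant [w]. *)
Lemma jump_complete X (R : nat -> nat -> bool) :
  decides (char X) (fun w => R (p1 w) (p2 w)) ->
  exists2 a, forall g, computes g a & forall w, jump X (a w) <-> exists z, R w z.
Proof.
move=> /decides_neg/computesP[c /eval_mu Hc].
exists (fun w => encode (CComp (CMu c) (const_code w))) => [g|w].
  rewrite /=; have := computes_encode_const (computes_id g); comput.
set a := encode _; rewrite /jump /= /varphi.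
rewrite /pdom /= {2}/a encodeK; split=> [[m [x /eval_const -> /Hc[Rm _]]]|ex].
  by exists m.
exists (ex_minn ex); exists w; first exact/eval_const.
apply/Hc; case: ex_minnP => m Rm le; split=> // j lt; apply/negP => /le; lia.
Qed.

Lemma char_true (X : set nat) n : X n -> char X n = 1.
Proof. by rewrite /char => Xn; case: asboolP. Qed.

Lemma char_false (X : set nat) n : ~ X n -> char X n = 0.
Proof. by rewrite /char => Xn; case: asboolP. Qed.

Lemma char_iff (X Y : set nat) m n : (X m <-> Y n) -> char X m = char Y n.
Proof.
by rewrite /char => H; case: asboolP => [/H|nX]; case: asboolP => // /H.
Qed.

Lemma computes_jump_complete X (R : nat -> nat -> bool) (Q : set nat) :
  decides (char X) (fun w => R (p1 w) (p2 w)) ->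
  (forall w, Q w <-> exists z, R w z) -> computes (char (jump X)) (char Q).
Proof.
move=> /jump_complete[a ca Ha] HQ.
have := computes_oracle (ca (char (jump X))).
by apply: eq_computes => w; apply: char_iff; rewrite Ha HQ.
Qed.

Lemma computes_jump X Y :
  computes (char Y) (char X) -> computes (char (jump Y)) (char (jump X)).
Proof.
move=> XY; apply: (computes_jump_complete (R := fun e D => halts (char X) e e D)).
  by comput.
by move=> e; apply: haltsP.
Qed.

(** * A normal form for computations relative to the double jump *)

(** A positive answer is confirmed by one witness, a negative one by the failure
    of all.  A derivation has finitely many queries, so the witnesses for its
    positive answers fit in one code [F], in front of all universal quantifiers. *)
Lemma truthful_char (Q : set nat) (S : nat -> nat -> Prop) D :
  (forall x, Q x <-> exists u, S x u) ->
  (forall i, i < p1 D -> is_query D i -> answer D i = char Q (query D i)) <->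
  exists F, forall i, i < p1 D -> is_query D i ->
    if answer D i == 0 then forall u, ~ S (query D i) u
    else answer D i = 1 /\ S (query D i) (nth_code F i).
Proof.
move=> HQ; split=> [H|[F H] i lt qi].
  have [i lt|F HF] := @finite_choice_code (fun i u => is_query D i ->
      if answer D i == 0 then forall u, ~ S (query D i) u
      else answer D i = 1 /\ S (query D i) u) (p1 D); last by exists F.
  case qi: (is_query D i); last by exists 0.
  rewrite (H i lt qi); case: (pselect (Q (query D i))) => [Qi|nQ].
    by have [u Su] := (HQ _).1 Qi; exists u; rewrite char_true.
  rewrite char_false //; exists 0 => _ u Su; apply: nQ; apply/HQ; by exists u.
have := H i lt qi; case: eqP => [-> nS|_ [-> Su]]; last first.
  by rewrite char_true //; apply/HQ; exists (nth_code F i).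
by rewrite char_false // => /HQ[u]; apply: nS.
Qed.

Definition halts0 := halts (fun=> 0).

(** Matrix of an exists-forall form of membership in the double jump; [u] packs
    a derivation with witnesses for its positive answers. *)
Definition dj_matrix (x u z : nat) : bool :=
  let D := p1 u in
  [&& valid D, bex (p1 D) (fun i => nth_fact D i == fact x x (answer D i)) &
      ball (p1 D) (fun i => is_query D i ==>
        if answer D i == 0 then ~~ halts0 (query D i) (query D i) z
        else (answer D i == 1) &&
             halts0 (query D i) (query D i) (nth_code (p2 u) i))].

Lemma char_set0 : char set0 = fun=> 0.
Proof. by apply/funext => n; rewrite char_false. Qed.

Lemma double_jumpE x :
  jump (jump set0) x <-> exists u, forall z, dj_matrix x u z.
Proof.
have K e : jump set0 e <-> exists D, halts0 e e D.
  by rewrite /jump /= char_set0 haltsP.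
rewrite /jump /= -/(jump set0) haltsP; split=> [[D]|[u Hu]].
  move=> /and3P[vD cD /ballP ora].
  have : forall i, i < p1 D -> is_query D i -> answer D i = char (jump set0) (query D i).
    by move=> i lt qi; have := ora i lt; rewrite qi => /eqP.
  move=> /(truthful_char _ K)[F HF]; exists (npair D F) => z.
  rewrite /dj_matrix !pairK; apply/and3P; split=> //.
  apply/ballP => i lt; apply/implyP => qi; have := HF i lt qi.
  case: eqP => [_ nz|_ [-> ->] //]; exact/negP.
have /and3P[vD cD _] := Hu 0; exists (p1 u); apply/and3P; split=> //.
suff ora : forall i, i < p1 (p1 u) -> is_query (p1 u) i ->
    answer (p1 u) i = char (jump set0) (query (p1 u) i).
  by apply/ballP => i lt; apply/implyP => qi; rewrite ora.
apply/(truthful_char _ K); exists (p2 u) => i lt qi.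
have Hi z : if answer (p1 u) i == 0
    then ~~ halts0 (query (p1 u) i) (query (p1 u) i) z
    else (answer (p1 u) i == 1) &&
         halts0 (query (p1 u) i) (query (p1 u) i) (nth_code (p2 u) i).
  by have /and3P[_ _ /ballP/(_ i lt)] := Hu z; rewrite qi.
move: Hi; case: eqP => _ Hi; first by move=> z; apply/negP.
by have /andP[/eqP -> ->] := Hi 0.
Qed.

Lemma decides_dj_matrix g x u z : computes g x -> computes g u -> computes g z ->
  decides g (fun w => dj_matrix (x w) (u w) (z w)).
Proof. by move=> cx cu cz; rewrite /dj_matrix /halts0; comput. Qed.
#[global] Hint Resolve decides_dj_matrix : comput.

(** Matrix of an exists-forall-exists form of [varphi (char 0'') n n v].  Here
    [j] packs a derivation with witnesses for its positive answers, and [y]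
    packs a position in the derivation with two instances of the universal
    quantifiers arising there. *)
Definition diag_matrix (v n j y z : nat) : bool :=
  let D := p1 j in let i := p1 y in
  [&& valid D, concludes D n n v &
      (i < p1 D) && is_query D i ==>
        if answer D i == 0 then ~~ dj_matrix (query D i) (p1 (p2 y)) z
        else (answer D i == 1) &&
             dj_matrix (query D i) (nth_code (p2 j) i) (p2 (p2 y))].

Lemma diag_matrixP v n :
  varphi (char (jump (jump set0))) n n v <->
  exists j, forall y, exists z, diag_matrix v n j y z.
Proof.
split=> [/evalP[D [vD cD]]|[j Hj]].
  move=> /(truthful_char _ double_jumpE)[F HF].
  exists (npair D F) => y; rewrite /diag_matrix !pairK vD cD /=.
  case: (boolP (_ && _)) => [/andP[lt qi]|_]; last by exists 0.
  have := HF _ lt qi; case: eqP => [_ /(_ (p1 (p2 y)))|_ [-> ->]]; last by exists 0.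
  by move=> /existsNP[z /negP nz]; exists z.
apply/evalP; exists (p1 j).
have Hi i u z0 : i < p1 (p1 j) -> is_query (p1 j) i -> exists z,
    if answer (p1 j) i == 0 then ~~ dj_matrix (query (p1 j) i) u z
    else (answer (p1 j) i == 1) &&
         dj_matrix (query (p1 j) i) (nth_code (p2 j) i) z0.
  move=> lt qi; have [z /and3P[_ _]] := Hj (npair i (npair u z0)).
  by rewrite !pairK lt qi => Hz; exists z.
have [_ /and3P[vD cD _]] := Hj 0; split=> //.
apply/(truthful_char _ double_jumpE); exists (p2 j) => i lt qi.
move: (fun u z0 => Hi i u z0 lt qi); case: eqP => _ {}Hi.
  by move=> u Hu; have [z /negP] := Hi u 0; apply; apply: Hu.
by have [_ /andP[/eqP -> _]] := Hi 0 0; split=> // z; have [_ /andP[]] := Hi 0 z.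
Qed.

Lemma decides_diag_matrix g v n j y z : computes g v -> computes g n ->
  computes g j -> computes g y -> computes g z ->
  decides g (fun w => diag_matrix (v w) (n w) (j w) (y w) (z w)).
Proof. by move=> *; rewrite /diag_matrix; comput. Qed.
#[global] Hint Resolve decides_diag_matrix : comput.

(** * A race between the two halves of the diagonal *)

Definition first_halt (e k s : nat) : bool :=
  halts0 e k s && ball s (fun D => ~~ halts0 e k D).

(** The finitely many events of [k] happen at the halting times of the programs
    [e <= k] on [k], and so the last of them dominates every partial computable
    function. *)
Definition event (k s : nat) : bool := bex k.+1 (fun e => first_halt e k s).

Lemma events_bounded k : exists M, forall s, event k s -> s <= M.
Proof.
have [e lt|F HF] := @finite_choice_code
    (fun e u => forall s, first_halt e k s -> s <= u) k.+1.
  case: (pselect (exists D, halts0 e k D)) => [[D hD]|nD].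
    exists D => s /andP[_ /ballP H]; rewrite leqNgt; apply/negP => /H.
    by rewrite hD.
  by exists 0 => s /andP[hs]; case: nD; exists s.
exists F => s /bexP[e lt he]; exact: leq_trans (HF e lt s he) (nth_code_le _ _).
Qed.

Lemma events_dominate psi : partial_computable psi ->
  exists N, forall k v, N <= k -> psi k v -> exists2 s, event k s & v < s.
Proof.
move=> [c ->]; exists (encode (CComp CSucc (decode c))) => k v le kv.
set e := encode _ in le; have ek : varphi (fun=> 0) e k v.+1.
  by rewrite /varphi /e encodeK; exists v.
have ex : exists D, halts0 e k D by apply/haltsP; exists v.+1.
exists (ex_minn ex); case: ex_minnP => D hD le'; last exact: halts_value ek hD.
apply/bexP; exists e => //; rewrite /first_halt hD.
by apply/ballP => D' lt; apply/negP => /le'; lia.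
Qed.

Definition evidence (v n k s j : nat) : bool :=
  ball k (fun y => bex s (fun z => diag_matrix v n j y z)).

(** The values 0 and 1 compete at stage [s] by their least witnesses that are
    confirmed up to precision [k]. *)
Definition leads (n k s : nat) : bool :=
  bex s (fun j => evidence 0 n k s j && ball j (fun i => ~~ evidence 1 n k s i)).

(** The two sides share the events, which no partial computable function bounds;
    hence the two sides cannot both be bounded. *)
Definition grows (side n k s : nat) : bool :=
  event k s && ((side == 0) == leads n k s).

Lemma decides_event g k s : computes g k -> computes g s ->
  decides g (fun w => event (k w) (s w)).
Proof. by move=> *; rewrite /event /first_halt /halts0; comput. Qed.

Lemma decides_evidence g v n k s j : computes g v -> computes g n ->
  computes g k -> computes g s -> computes g j ->
  decides g (fun w => evidence (v w) (n w) (k w) (s w) (j w)).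
Proof. by move=> *; rewrite /evidence; comput. Qed.
#[global] Hint Resolve decides_event decides_evidence : comput.

Lemma decides_leads g n k s : computes g n -> computes g k -> computes g s ->
  decides g (fun w => leads (n w) (k w) (s w)).
Proof. by move=> *; rewrite /leads; comput. Qed.
#[global] Hint Resolve decides_leads : comput.

Lemma decides_grows g side n k s : computes g side -> computes g n ->
  computes g k -> computes g s ->
  decides g (fun w => grows (side w) (n w) (k w) (s w)).
Proof. by move=> *; rewrite /grows; comput. Qed.
#[global] Hint Resolve decides_grows : comput.

Lemma evidence_mono v n k s s' j :
  s <= s' -> evidence v n k s j -> evidence v n k s' j.
Proof.
move=> le /ballP H; apply/ballP => y /H/bexP[z lt Hz].
by apply/bexP; exists z => //; lia.
Qed.

(** The finitely many competitors [i <= j] of the true witness [j] each fail at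
    some precision, and beyond [K] they all do; a search finds a stage at which
    [j] itself is confirmed. *)
Lemma evidence_settles g v w n :
  varphi (char (jump (jump set0))) n n v ->
  ~ varphi (char (jump (jump set0))) n n w ->
  exists j b K, computes g b /\ forall k s, K <= k -> b k <= s ->
    [/\ j < s, evidence v n k s j & forall i, i <= j -> ~~ evidence w n k s i].
Proof.
move=> /diag_matrixP[j Hj] /diag_matrixP nw.
have ex k : exists s, evidence v n k s j.
  have [y _|F HF] := @finite_choice_code (fun y z => diag_matrix v n j y z) k.
    exact: Hj.
  exists F.+1; apply/ballP => y lt; apply/bexP; exists (nth_code F y); last exact: HF.
  by rewrite ltnS nth_code_le.
have [b cb Hb] := @computes_min g (fun k s => evidence v n k s j)
  (ltac:(comput)) ex.
have [i le|F HF] := @finite_choice_code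
    (fun i y => forall z, ~~ diag_matrix w n i y z) j.+1.
  apply: contrapT => nH; apply: nw; exists i => y.
  apply: contrapT => nz; apply: nH; exists y => z.
  by apply/negP => Hz; apply: nz; exists z.
exists j, (fun k => b k + j.+1), F.+1; split=> [|k s leK les]; first comput.
split; first lia.
  by apply: evidence_mono (Hb k); lia.
move=> i le; apply/negP => /ballP/(_ (nth_code F i)).
have lt : nth_code F i < k by have := nth_code_le F i; lia.
by move=> /(_ lt)/bexP[z _]; apply/negP; apply: HF.
Qed.

(** For [k >= K] the race is over from stage [b k] on, and each [k < K] has only
    finitely many events; so the side against the true value is bounded. *)
Lemma grows_bounded g side n :
  varphi (char (jump (jump set0))) n n (side == 0) ->
  exists2 b, computes g b & forall k s, grows side n k s -> s <= b k.
Proof.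
move=> true_val.
have [j [b [K [cb Hb]]]] := @evidence_settles g (side == 0) (side != 0) n
  true_val (fun false_val =>
    ltac:(by have := eval_functional true_val false_val; case: (side == 0))).
have stops k s : K <= k -> b k <= s -> ~~ grows side n k s.
  move=> leK les; have [ltj ej ne] := Hb k s leK les.
  rewrite /grows negb_and; apply/orP; right; move: ej ne.
  case: (side == 0) => /= ej ne; last first.
    rewrite negbK; apply/bexP; exists j => //; rewrite ej.
    by apply/ballP => i lti; apply: ne; lia.
  apply/bexP => -[i lti /andP[ei /ballP ni]].
  case: (leqP i j) => [/ne|/ni]; [by rewrite ei|by rewrite ej].
have [k lt|M HM] := @finite_choice_code
    (fun k M => forall s, event k s -> s <= M) K; first exact: events_bounded.
exists (fun k => b k + M) => [|k s gr]; first by comput.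
case: (leqP K k) => [leK|ltK].
  rewrite leqNgt; apply/negP => lt; have /negP := stops k s leK (ltac:(lia)); exact.
have /HM/(_ s) : k < K by []. case/andP: gr => -> _ /(_ isT).
have := nth_code_le M k; lia.
Qed.

(** * Cohesive powers *)

Lemma almost_subsetP (C Y : set nat) :
  almost_subset C Y <-> exists N, forall i, C i -> N <= i -> Y i.
Proof.
split=> [/finite_seqP[s Es]|[N HN]].
  exists (\max_(x <- s) x).+1 => i Ci le; apply: contrapT => nY.
  have : (C `\` Y)%classic i by [].
  rewrite Es /= => /(fun h => @leq_bigmax_seq _ s xpredT id i h isT); lia.
apply: (@sub_finite_set _ _ `I_N); last exact: finite_II.
by move=> i [Ci nY] /=; rewrite ltnNge; apply/negP => /HN-/(_ Ci).
Qed.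

Lemma almost_mono (C Y Z : set nat) :
  (forall i, Y i -> Z i) -> almost_subset C Y -> almost_subset C Z.
Proof.
move=> YZ /almost_subsetP[N HN]; apply/almost_subsetP; exists N => i Ci le.
exact/YZ/HN.
Qed.

Lemma almost_and (C Y Z : set nat) : almost_subset C Y -> almost_subset C Z ->
  almost_subset C [set i | Y i /\ Z i].
Proof.
move=> /almost_subsetP[N HN] /almost_subsetP[M HM]; apply/almost_subsetP.
by exists (maxn N M) => i Ci; rewrite geq_max => /andP[leN leM]; split; auto.
Qed.

Lemma almost_ball (C : set nat) (Y : nat -> set nat) m :
  (forall j, j < m -> almost_subset C (Y j)) ->
  almost_subset C [set i | forall j, j < m -> Y j i].
Proof.
elim: m => [_|m IH H]; first by apply/almost_subsetP; exists 0.
have [|Ym Yl] := (IH _, H m (ltnSn m)); first by move=> j lt; apply: H; lia.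
apply: almost_mono (almost_and Ym Yl) => i [Hi Hm] j.
by rewrite ltnS leq_eqVlt => /orP[/eqP ->|/Hi].
Qed.

Lemma almost_inhabited (C Y : set nat) N : infinite_set C ->
  almost_subset C Y -> exists2 i, C i /\ N <= i & Y i.
Proof.
move=> infC /almost_subsetP[M HM]; apply: contrapT => H; apply: infC.
apply: (@sub_finite_set _ _ `I_(maxn M N)); last exact: finite_II.
move=> i Ci /=; rewrite ltnNge geq_max; apply/negP => /andP[leM leN].
by apply: H; exists i => //; apply: HM.
Qed.

Lemma partial_computableP phi :
  partial_computable phi <-> exists c, phi = eval (fun=> 0) c.
Proof.
split=> [[e ->]|[c ->]]; first by exists (decode e).
by exists (encode c); rewrite /varphi encodeK.
Qed.

Lemma pc_functional phi n a b :
  partial_computable phi -> phi n a -> phi n b -> a = b.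
Proof. by move=> [e ->]; apply: eval_functional. Qed.

Lemma pc_total f :
  computes (fun=> 0) f -> partial_computable (fun n m => m = f n).
Proof.
move=> /computesP[c Hc]; apply/partial_computableP; exists c.
apply/funext => n; apply/funext => m; apply/propext.
by split=> [->|/eval_functional/(_ (Hc n))].
Qed.

Lemma pc_comp f phi : computes (fun=> 0) f -> partial_computable phi ->
  partial_computable (fun n m => exists2 a, phi n a & m = f a).
Proof.
move=> /pc_total/partial_computableP[c Hc] /partial_computableP[d ->].
apply/partial_computableP; exists (CComp c d).
apply/funext => n; apply/funext => m; apply/propext => /=; rewrite -Hc.
by split=> -[a]; exists a.
Qed.

Lemma pc_pair phi psi : partial_computable phi -> partial_computable psi ->
  partial_computable
    (fun n m => exists x y, [/\ phi n x, psi n y & m = npair x y]).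
Proof.
move=> /partial_computableP[c ->] /partial_computableP[d ->].
by apply/partial_computableP; exists (CPair c d).
Qed.

Lemma pc_search (b : nat -> nat -> bool) phi :
  decides (fun=> 0) (fun w => b (p1 w) (p2 w)) -> partial_computable phi ->
  partial_computable (fun n z => exists2 a, phi n a &
    b a z /\ forall j, j < z -> ~~ b a j).
Proof.
move=> /decides_neg/computesP[c /eval_mu Hc] /partial_computableP[d ->].
apply/partial_computableP; exists (CComp (CMu c) d).
apply/funext => n; apply/funext => m; apply/propext.
by split=> -[a Ha /Hc]; exists a.
Qed.

Lemma exists_min (b : nat -> bool) :
  (exists z, b z) -> exists2 z, b z & forall j, j < z -> ~~ b j.
Proof.
move=> ex; exists (ex_minn ex); case: ex_minnP => // m _ le j lt.
by apply/negP => /le; lia.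
Qed.

(** The arguments where the search succeeds form a c.e. set, the domain of the
    partial computable function that returns the first success. *)
Lemma cohesive_search (C : set nat) (b : nat -> nat -> bool) phi :
  cohesive C -> decides (fun=> 0) (fun w => b (p1 w) (p2 w)) ->
  partial_computable phi ->
  almost_subset C [set n | exists2 a, phi n a & exists z, b a z] \/
  almost_subset C [set n | forall a, phi n a -> forall z, ~~ b a z].
Proof.
move=> [_ coh] cb cphi.
have [H|H] := coh _ (ex_intro2 _ _ _ (pc_search cb cphi) erefl).
- by left; apply: almost_mono H => n [z [a an [bz _]]]; exists a => //; exists z.
- right; apply: almost_mono H => n nH a an z; apply/negP => bz; apply: nH.
  by have [x bx lx] := exists_min (ex_intro _ z bz); exists x; exists a.
Qed.

Lemma cohesive_decides (C : set nat) (b : nat -> bool) phi :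
  cohesive C -> decides (fun=> 0) b -> partial_computable phi ->
  almost_subset C (pdom phi) ->
  almost_subset C [set n | forall a, phi n a -> b a] \/
  almost_subset C [set n | forall a, phi n a -> ~~ b a].
Proof.
move=> coh cb cphi dphi.
have [Ct|Cf] := cohesive_search (b := fun a _ => b a) coh
  (computes_comp cb (computes_p1 (computes_id _))) cphi.
- left; apply: almost_mono Ct => n [a an [_ ba]] a' an'.
  by rewrite (pc_functional cphi an' an).
- by right; apply: almost_mono Cf => n H a /H/(_ 0).
Qed.

Definition immediate T (M : structure T) (x y : T) : Prop :=
  prec M x y /\ forall z, ~ (prec M x z /\ prec M z y).

Definition decidable_structure (L : structure nat) : Prop :=
  [/\ is_structure L, decides (fun=> 0) (fun x => `[< dom L x >]) &
      decides (fun=> 0) (fun w => `[< prec L (p1 w) (p2 w) >])].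

Section Power.
Variables (L : structure nat) (C : set nat).
Hypotheses (decL : decidable_structure L) (cohC : cohesive C).
Let Pi := cohesive_power L C.
Let cl := power_class L C.

Let prec_dom x y : prec L x y -> dom L x /\ dom L y.
Proof. by case: decL => -[_ H] _ _; apply: H. Qed.

Lemma power_dom E : dom Pi E -> exists2 phi, power_fun L C phi & E = cl phi.
Proof. by move=> [phi pphi <-]; exists phi. Qed.

Lemma power_prec_dom E F : prec Pi E F -> dom Pi E /\ dom Pi F.
Proof. by move=> [phi [psi [pphi ppsi -> -> _]]]; split; [exists phi|exists psi]. Qed.

Lemma power_class_eq phi psi : power_fun L C phi -> cl phi = cl psi ->
  almost_subset C [set n | exists2 m, psi n m & phi n m].
Proof.
move=> pphi E; suff [_ //] : cl psi phi by [].
rewrite -E; split=> //; have [_ _] := pphi.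
by apply: almost_mono => n [m nm]; exists m.
Qed.

Lemma power_precP phi psi : power_fun L C phi -> power_fun L C psi ->
  prec Pi (cl phi) (cl psi) <->
  almost_subset C [set n | exists a b, [/\ phi n a, psi n b & prec L a b]].
Proof.
move=> pphi ppsi; split=> [[phi' [psi' [pphi' ppsi' Ep Eq H]]]|H]; last first.
  by exists phi, psi.
apply: almost_mono (almost_and H (almost_and (power_class_eq pphi Ep)
  (power_class_eq ppsi Eq))) => n [[a [b [pa pb ab]]] [[a' ha ha'] [b' hb hb']]].
have [[cp _ _] [cq _ _]] := (pphi', ppsi'); exists a, b; split=> //.
  by rewrite (pc_functional cp pa ha).
by rewrite (pc_functional cq pb hb).
Qed.

Lemma between_computable : decides (fun=> 0)
  (fun w => `[< prec L (p1 (p1 w)) (p2 w) >] && `[< prec L (p2 w) (p2 (p1 w)) >]).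
Proof.
have [_ _ cp] := decL.
apply: decides_and.
  have := computes_comp cp (h := fun w => npair (p1 (p1 w)) (p2 w)) (ltac:(comput)).
  by apply: eq_computes => w; rewrite !pairK.
have := computes_comp cp (h := fun w => npair (p2 w) (p2 (p1 w))) (ltac:(comput)).
by apply: eq_computes => w; rewrite !pairK.
Qed.

(** Immediate successions are decided pointwise: either an element in between is
    found by a computable search along [C], or there is almost always none. *)
Lemma power_immediateP phi psi : power_fun L C phi -> power_fun L C psi ->
  immediate Pi (cl phi) (cl psi) <->
  almost_subset C [set n | exists a b, [/\ phi n a, psi n b & immediate L a b]].
Proof.
move=> pphi ppsi; have [[cphi _ _] [cpsi _ _]] := (pphi, ppsi).
split=> [[/power_precP lt nbet]|H].
  have cpp := pc_pair cphi cpsi.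
  have [found|none] := cohesive_search
    (b := fun c z => `[< prec L (p1 c) z >] && `[< prec L z (p2 c) >])
    cohC between_computable cpp.
    pose zeta n z := exists2 c, (exists x y, [/\ phi n x, psi n y & c = npair x y]) &
      (`[< prec L (p1 c) z >] && `[< prec L z (p2 c) >]) /\
      forall j, j < z -> ~~ (`[< prec L (p1 c) j >] && `[< prec L j (p2 c) >]).
    have pz : power_fun L C zeta.
      split; first by apply: pc_search => //; exact: between_computable.
        by move=> n z [c _ [/andP[/asboolP /prec_dom[] ]]].
      apply: almost_mono found => n [c Hc ex].
      by have [z bz lz] := exists_min ex; exists z, c.
    have some n : (exists2 c, (exists x y, [/\ phi n x, psi n y & c = npair x y]) &
        exists z, `[< prec L (p1 c) z >] && `[< prec L z (p2 c) >]) ->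
        exists a z b, [/\ phi n a, zeta n z, psi n b, prec L a z & prec L z b].
      move=> [c [x [y [px py E]]] ex]; have [z bz lz] := exists_min ex.
      exists x, z, y; have [/asboolP + /asboolP] := andP bz.
      by rewrite E !pairK; split=> //; exists c => //; exists x, y.
    case: (nbet (cl zeta)); split; apply/power_precP => //;
      apply: almost_mono found => n /some[a [z [b []]]];
      [by exists a, z|by exists z, b].
  have := almost_and (lt pphi ppsi) none; apply: almost_mono.
  move=> n [[a [b [pa pb ab]]] nz]; exists a, b; split=> //; split=> // z [az zb].
  have := nz (npair a b) (ltac:(by exists a, b)) z.
  by rewrite !pairK; case: asboolP => //; case: asboolP.
split.
  by apply/power_precP => //; apply: almost_mono H => n [a [b [pa pb []]]]; exists a, b.
move=> E [pE Eq]; have [/power_dom[zeta pz Ez] _] := power_prec_dom Eq.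
move: pE Eq; rewrite {}Ez => /power_precP Hl /power_precP Hr.
have [i _] := almost_inhabited 0 cohC.1
  (almost_and H (almost_and (Hl pphi pz) (Hr pz ppsi))).
move=> [[a [b [pa pb [_ nab]]]] [[a' [z [pa' pzz az]]] [z' [b' [pz' pb' zb]]]]].
have [cz _ _] := pz; apply: (nab z); split.
  by rewrite (pc_functional cphi pa pa').
by rewrite (pc_functional cpsi pb pb') (pc_functional cz pzz pz').
Qed.

(** A computable function of the elements, with values outside of the order
    replaced by the argument, acts on the power. *)
Definition act (f : nat -> nat) (phi : pfun) : pfun := fun n m =>
  exists2 a, phi n a & m = if `[< dom L (f a) >] then f a else a.

Lemma power_act f phi :
  computes (fun=> 0) f -> power_fun L C phi -> power_fun L C (act f phi).
Proof.
move=> cf [cphi dphi aphi]; have [_ cd _] := decL; split.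
- apply: (pc_comp (f := fun a => if `[< dom L (f a) >] then f a else a)) => //.
  apply: computes_if; [exact: (computes_comp cd cf)|exact: cf|exact: computes_id].
- by move=> n m [a /dphi da ->]; case: asboolP.
- apply: almost_mono aphi => n [a pa]; by eexists; exists a.
Qed.

Lemma immediate_pred_act f phi : computes (fun=> 0) f -> power_fun L C phi ->
  almost_subset C [set n | forall a, phi n a -> immediate L (f a) a] ->
  immediate Pi (cl (act f phi)) (cl phi).
Proof.
move=> cf pphi H; have [_ _ aphi] := pphi.
apply/power_immediateP => //; first exact: power_act.
apply: almost_mono (almost_and H aphi) => n [Hi [a pa]].
have im := Hi a pa; exists (f a), a; split=> //; exists a => //.
by have [/prec_dom[da _] _] := im; case: asboolP.
Qed.

Lemma immediate_succ_act f phi : computes (fun=> 0) f -> power_fun L C phi ->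
  almost_subset C [set n | forall a, phi n a -> immediate L a (f a)] ->
  immediate Pi (cl phi) (cl (act f phi)).
Proof.
move=> cf pphi H; have [_ _ aphi] := pphi.
apply/power_immediateP => //; first exact: power_act.
apply: almost_mono (almost_and H aphi) => n [Hi [a pa]].
have im := Hi a pa; exists a, (f a); split=> //; exists a => //.
by have [/prec_dom[_ da] _] := im; case: asboolP.
Qed.

End Power.

(** In a linear order and for [0 < m], a maximal set of consecutive elements, of
    size [m]. *)
Definition block T (M : structure T) (m : nat) : Prop :=
  exists x : nat -> T,
    [/\ forall j, j < m -> dom M (x j),
        forall j, j.+1 < m -> immediate M (x j) (x j.+1),
        forall y, ~ immediate M y (x 0) &
        forall y, ~ immediate M (x m.-1) y].

Lemma block_isomorphic T U (M : structure T) (N : structure U) m : 0 < m ->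
  (forall x y, prec M x y -> dom M x /\ dom M y) ->
  (forall x y, prec N x y -> dom N x /\ dom N y) ->
  isomorphic M N -> block M m <-> block N m.
Proof.
move=> m0 domM domN [f [fM finj fsur] fprec].
have imm x y : dom M x -> dom M y -> immediate M x y <-> immediate N (f x) (f y).
  move=> dx dy; split=> -[pxy nb]; split; try exact/(fprec x y dx dy).
    move=> z [xz zy]; have [dz _] := domN _ _ zy; have [z' dz' Ez] := fsur z dz.
    by apply: (nb z'); split; apply/fprec; rewrite // Ez.
  move=> z [xz zy]; have [dz _] := domM _ _ zy.
  by apply: (nb (f z)); split; apply/fprec.
have immM x y : immediate M x y -> dom M x /\ dom M y by move=> [/domM].
have immN x y : immediate N x y -> dom N x /\ dom N y by move=> [/domN].
split=> -[x [dx xx xl xr]].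
  have x0 : dom M (x 0) by exact: dx.
  have xm : dom M (x m.-1) by apply: dx; lia.
  exists (f \o x); split=> /=.
  - by move=> j /dx; apply: fM.
  - by move=> j lt; apply/imm; [apply: dx; lia|exact: dx|exact: xx].
  - move=> y im; have [dy _] := immN _ _ im; have [y' dy' Ey] := fsur y dy.
    by apply: (xl y'); apply/imm; rewrite // Ey.
  - move=> y im; have [_ dy] := immN _ _ im; have [y' dy' Ey] := fsur y dy.
    by apply: (xr y'); apply/imm; rewrite // Ey.
have [j|x' Hx'] := @choice nat T (fun j a => j < m -> dom M a /\ f a = x j).
  case: (ltnP j m) => lt; last by have [a da _] := fsur _ (dx 0 m0); exists a.
  by have [a da Ea] := fsur _ (dx j lt); exists a.
have [d0 E0] := Hx' 0 m0; have [|dm Em] := Hx' m.-1; first by lia.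
exists x'; split.
- by move=> j /Hx'[].
- move=> j lt; have [dj Ej] := Hx' j (ltnW lt); have [dj' Ej'] := Hx' _ lt.
  by apply/imm; rewrite // Ej Ej'; apply: xx.
- move=> y im; have [dy _] := immM _ _ im.
  by apply: (xl (f y)); rewrite -E0; apply/imm.
- move=> y im; have [_ dy] := immM _ _ im.
  by apply: (xr (f y)); rewrite -Em; apply/imm.
Qed.

(** * The order of pieces *)

Section Pieces.
Variables (M : nat -> nat) (G : nat -> nat -> bool).

(** Elements are triples of an index, a slot and an offset, ordered with the
    indices and slots ascending and the offsets descending.  Index [2p] is the
    tail of piece [p]: a copy of omega* in slot [0] and in each slot [s] with
    [G p s].  Index [2p+1] is its core, of [M p] elements.  The core has an
    immediate predecessor exactly when there is a last tail slot. *)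
Definition element (i s q : nat) : nat := npair i (npair s q).
Notation index x := (p1 x).
Notation slot x := (p1 (p2 x)).
Notation offset x := (p2 (p2 x)).

Definition in_pieces (x : nat) : bool :=
  if odd (index x) then (slot x == 0) && (offset x < M (index x)./2)
  else (slot x == 0) || G (index x)./2 (slot x).

Definition pieces_lt (x y : nat) : bool :=
  [&& in_pieces x, in_pieces y &
      (index x < index y) || (index x == index y) &&
      ((slot x < slot y) || (slot x == slot y) && (offset y < offset x))].

Definition pieces : structure nat :=
  {| dom := [set x | in_pieces x]; prec x y := pieces_lt x y |}.

Lemma index_element i s q : index (element i s q) = i.
Proof. by rewrite /element pairK. Qed.
Lemma slot_element i s q : slot (element i s q) = s.
Proof. by rewrite /element !pairK. Qed.
Lemma offset_element i s q : offset (element i s q) = q.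
Proof. by rewrite /element !pairK. Qed.
Definition elementE := (index_element, slot_element, offset_element).

Lemma element_ext x y :
  index x = index y -> slot x = slot y -> offset x = offset y -> x = y.
Proof. by move=> e1 e2 e3; rewrite -(pair_p x) -(pair_p (p2 x)) e1 e2 e3 !pair_p. Qed.

Lemma pieces_linear : linear_order pieces.
Proof.
split.
- split; first by exists (element 0 0 0); rewrite /= /in_pieces !elementE.
  by move=> x y /and3P[].
- move=> x /and3P[_ _]; lia.
- move=> x y z /and3P[dx dy xy] /and3P[_ dz yz]; apply/and3P; split=> //; lia.
- move=> x y /= dx dy; rewrite /pieces_lt dx dy /=.
  case: (ltngtP (index x) (index y)) => [lt|lt|ei] /=;
    [exact: Or31|exact: Or33|].
  case: (ltngtP (slot x) (slot y)) => [lt|lt|es] /=; [exact: Or31|exact: Or33|].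
  case: (ltngtP (offset x) (offset y)) => [lt|lt|eo];
    [exact: Or33|exact: Or31|by apply: Or32; apply: element_ext].
Qed.

Lemma immediate_succ_unique x y y' :
  immediate pieces x y -> immediate pieces x y' -> y = y'.
Proof.
have [_ _ _ tot] := pieces_linear; have [[_ st] _ _ _] := pieces_linear.
move=> [xy nby] [xy' nby']; have [_ dy] := st _ _ xy; have [_ dy'] := st _ _ xy'.
by case: (tot y y' dy dy') => // lt; [case: (nby' y)|case: (nby y')].
Qed.

(** Within a copy of omega*, and within a core, offsets are successive. *)
Lemma immediate_offset i s q :
  in_pieces (element i s q) -> ~~ odd i || (q.+1 < M i./2) ->
  immediate pieces (element i s q.+1) (element i s q).
Proof.
move=> dx H; have dy : in_pieces (element i s q.+1).
  by move: dx H; rewrite /in_pieces !elementE; case: (odd i) => //= /andP[-> _].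
split; first by rewrite /= /pieces_lt dx dy !elementE; lia.
move=> z [/and3P[_ _]]; rewrite !elementE => lz /and3P[_ _]; rewrite !elementE; lia.
Qed.

Lemma core_end_no_succ i y : odd i -> ~ immediate pieces (element i 0 0) y.
Proof.
move=> oi [/and3P[dx dy]]; rewrite !elementE => lt; case/(_ (element i.+1 0 (offset y).+1)).
have dz : in_pieces (element i.+1 0 (offset y).+1).
  by rewrite /in_pieces !elementE /= oi.
have sy : index y = i -> slot y = 0.
  by move=> ey; move: dy; rewrite /in_pieces ey oi => /andP[/eqP].
by split; rewrite /= /pieces_lt ?dx ?dy ?dz !elementE; lia.
Qed.

(** A tail slot above that of [y] would hold an element in between. *)
Lemma core_pred_bound p y :
  immediate pieces y (element p.*2.+1 0 (M p).-1) -> forall s, G p s -> s <= slot y.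
Proof.
move=> [/and3P[dy dx]]; rewrite !elementE => lt nb s Gs.
rewrite leqNgt; apply/negP => lts; case: (nb (element p.*2 s 0)).
have dz : in_pieces (element p.*2 s 0).
  by rewrite /in_pieces !elementE odd_double doubleK Gs orbT.
move: dy; rewrite /in_pieces => dy.
have ney : index y != p.*2.+1.
  apply/eqP => ey; move: dy lt; rewrite ey /= odd_double /= uphalf_double; lia.
split; rewrite /= /pieces_lt dz ?dx ?[in_pieces y]dy !elementE; lia.
Qed.

Lemma core_pred_last p s : 0 < M p -> (s == 0) || G p s ->
  (forall s', G p s' -> s' <= s) ->
  immediate pieces (element p.*2 s 0) (element p.*2.+1 0 (M p).-1).
Proof.
move=> M0 ds last; split.
  apply/and3P; split; rewrite /in_pieces !elementE /= ?odd_double ?doubleK //=.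
    by rewrite uphalf_double; lia.
  lia.
move=> z [/and3P[_ dz]]; rewrite !elementE => lz /and3P[_ _]; rewrite !elementE.
move: dz; rewrite /in_pieces.
have [ei|ei] := eqVneq (index z) p.*2.
  rewrite ei odd_double doubleK => /orP[|/last]; lia.
have [ei'|ei'] := eqVneq (index z) p.*2.+1; last lia.
rewrite ei' /= odd_double /= uphalf_double => /andP[]; lia.
Qed.

Hypothesis cM : forall g f, computes g f -> computes g (fun z => M (f z)).
Hypothesis cG : forall g f h, computes g f -> computes g h ->
  decides g (fun z => G (f z) (h z)).

Lemma decides_in_pieces g f : computes g f -> decides g (fun z => in_pieces (f z)).
Proof.
move=> cf; rewrite /in_pieces; apply: decides_if; first comput.
  by have := cM (f := fun z => (p1 (f z))./2) (ltac:(comput)); comput.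
apply: decides_or; first comput; apply: cG; comput.
Qed.

Lemma decides_pieces_lt g f h : computes g f -> computes g h ->
  decides g (fun z => pieces_lt (f z) (h z)).
Proof.
move=> cf ch; have df := decides_in_pieces cf; have dh := decides_in_pieces ch.
by rewrite /pieces_lt; comput.
Qed.

Lemma asbool_bool (b : bool) : `[< b >] = b.
Proof. by apply/idP/idP => /asboolP. Qed.

Lemma pieces_decidable : decidable_structure pieces.
Proof.
split; first by case: pieces_linear.
  by apply: eq_computes (decides_in_pieces (computes_id _)) => x; rewrite /= asbool_bool.
have := decides_pieces_lt (computes_p1 (computes_id (fun=> 0)))
  (computes_p2 (computes_id _)).
by apply: eq_computes => x; rewrite /= asbool_bool.
Qed.

Lemma pieces_computable : computable (struct_set pieces).
Proof.
have : decides (fun=> 0) (fun n => if odd n then pieces_lt (p1 n./2) (p2 n./2)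
                                   else in_pieces n./2).
  by apply: decides_if; [comput|apply: decides_pieces_lt|apply: decides_in_pieces];
    comput.
apply: eq_computes => n; rewrite /char /struct_set /= of_natE.
by case: (odd n); rewrite asbool_bool.
Qed.

Variable C : set nat.
Hypothesis cohC : cohesive C.
Let decL := pieces_decidable.
Let cl := power_class pieces C.

(** An immediate predecessor of the first core element would have a slot above all
    those of the tail of [kappa i], for almost all [i] in [C], and so give a
    partial computable bound. *)
Lemma block_of_unbounded m kappa : 0 < m -> computes (fun=> 0) kappa ->
  (forall i, M (kappa i) = m) ->
  (forall psi, partial_computable psi -> ~ almost_subset C
     [set i | exists2 v, psi i v & forall s, G (kappa i) s -> s <= v]) ->
  block (cohesive_power pieces C) m.
Proof.
move=> m0 ck Mk unb.
pose x j := fun n k : nat => k = element (kappa n).*2.+1 0 (m.-1 - j).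
have dx n q : q < m -> in_pieces (element (kappa n).*2.+1 0 q).
  by move=> lt; rewrite /in_pieces !elementE /= odd_double /= uphalf_double Mk.
have px j : power_fun pieces C (x j).
  split; first by apply: pc_total; rewrite /element; comput.
    by move=> n k -> ; apply: dx; lia.
  apply/almost_subsetP; exists 0 => i _ _; by eexists.
exists (fun j => cl (x j)); split.
- by move=> j _; exists (x j).
- move=> j lt; apply/power_immediateP => //.
  apply/almost_subsetP; exists 0 => i _ _; exists (element (kappa i).*2.+1 0 (m.-1 - j)).
  exists (element (kappa i).*2.+1 0 (m.-1 - j.+1)); split=> //.
  have -> : m.-1 - j = (m.-1 - j.+1).+1 by lia.
  apply: immediate_offset; first by apply: dx; lia.
  by rewrite /= odd_double /= uphalf_double Mk; lia.
- move=> y im; have [/power_dom[psi ppsi Ey] _] := power_prec_dom im.1.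
  move: im; rewrite Ey => /(power_immediateP decL cohC ppsi (px 0)) im.
  case: ppsi => cpsi _ _.
  apply: (unb _ (pc_comp (f := fun a => slot a) (ltac:(comput)) cpsi)).
  apply: almost_mono im => n [a [b [pa -> ]]].
  rewrite subn0 -(Mk n) => /core_pred_bound H; exists (slot a) => //; by exists a.
- move=> y im; have [_ /power_dom[psi ppsi Ey]] := power_prec_dom im.1.
  move: im; rewrite Ey => /(power_immediateP decL cohC (px _) ppsi) im.
  have [i _ [a [b [-> pb]]]] := almost_inhabited 0 cohC.1 im.
  by rewrite subnn; apply: core_end_no_succ; rewrite /= odd_double.
Qed.

Definition last_slot (p b : nat) : nat :=
  iteri b.+1 (fun s r => if G p s then s else r) 0.

Lemma last_slotP p b : (forall s, G p s -> s <= b) ->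
  ((last_slot p b == 0) || G p (last_slot p b)) /\
  forall s, G p s -> s <= last_slot p b.
Proof.
rewrite /last_slot => Hb.
have Hn n : let r := iteri n (fun s r => if G p s then s else r) 0 in
    ((r == 0) || G p r) /\ forall s, s < n -> G p s -> s <= r.
  elim: n => //= n [IH1 IH2]; case E: (G p n); split=> //.
  - by rewrite E orbT.
  - by move=> s; rewrite ltnS leq_eqVlt => /orP[/eqP ->|/IH2]; rewrite ?E.
by have [H1 H2] := Hn b.+1; split=> // s Gs; apply: H2 => //; rewrite ltnS; apply: Hb.
Qed.

(** Offsets are successive, so a block must consist of whole cores.  With a
    computable bound the last tail slot is computable, and it gives the first
    core element an immediate predecessor. *)
Lemma no_block_of_bounded m b : 0 < m -> computes (fun=> 0) b ->
  (forall p, M p = m -> forall s, G p s -> s <= b p) ->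
  ~ block (cohesive_power pieces C) m.
Proof.
move=> m0 cb Hb [X [dX XX Xl Xr]].
have [j|x Hx] := @choice nat pfun (fun j phi =>
    j < m -> power_fun pieces C phi /\ X j = cl phi).
  case: (ltnP j m) => [/dX/power_dom[phi pphi E]|_]; first by exists phi.
  by exists (fun _ _ => False).
have px j lt := (Hx j lt).1; have Ex j lt := (Hx j lt).2.
have cx j (lt : j < m) : partial_computable (x j) by case: (px j lt).
have ax j (lt : j < m) : almost_subset C (pdom (x j)) by case: (px j lt).
have lt_last : m.-1 < m by lia.
have no_pred f : computes (fun=> 0) f -> ~ almost_subset C
    [set n | forall a, x 0 n a -> immediate pieces (f a) a].
  move=> cf /(immediate_pred_act decL cohC cf (px 0 m0)) im.
  by apply: (Xl (cl (act pieces f (x 0)))); rewrite (Ex 0 m0).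
have no_succ f : computes (fun=> 0) f -> ~ almost_subset C
    [set n | forall a, x m.-1 n a -> immediate pieces a (f a)].
  move=> cf /(immediate_succ_act decL cohC cf (px _ lt_last)) im.
  by apply: (Xr (cl (act pieces f (x m.-1)))); rewrite (Ex _ lt_last).
have chain j : j.+1 < m -> almost_subset C
    [set n | forall a c, x j n a -> x j.+1 n c -> immediate pieces a c].
  move=> lt; have lt' := ltnW lt; have := XX j lt; rewrite (Ex _ lt) (Ex _ lt').
  move=> /(power_immediateP decL cohC (px _ lt') (px _ lt)).
  apply: almost_mono => n [a [c [pa pc im]]] a' c' pa' pc'.
  by rewrite -(pc_functional (cx _ lt') pa pa') -(pc_functional (cx _ lt) pc pc').
have elemE a : a = element (index a) (slot a) (offset a).
  by rewrite /element !pair_p.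
(* Otherwise the next offset is an immediate predecessor. *)
have first : almost_subset C [set n | forall a, x 0 n a ->
    [/\ odd (index a), slot a = 0 & (offset a).+1 = M (index a)./2]].
  have [|H|H] := cohesive_decides (b := fun a => ~~ odd (index a) ||
      ((offset a).+1 < M (index a)./2)) cohC _ (cx 0 m0) (ax 0 m0).
  - apply: decides_or; first comput.
    by have := cM (f := fun z => (p1 z)./2) (ltac:(comput)); comput.
  - case: (@no_pred (fun a => element (index a) (slot a) (offset a).+1)).
      by rewrite /element; comput.
    apply: almost_mono H => n Hn a pa.
    have := @immediate_offset (index a) (slot a) (offset a); rewrite -elemE.
    by apply; [case: (px 0 m0) => _ /(_ n a pa)|exact: Hn].
  apply: almost_mono H => n Hn a pa; have := Hn a pa.
  have [_ /(_ n a pa) + _] := px 0 m0; rewrite /= /in_pieces.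
  by case: (odd _) => //= /andP[/eqP -> lt]; split=> //; lia.
have all_in : almost_subset C [set n | forall j, j < m -> pdom (x j) n].
  by apply: almost_ball => j /ax.
have all_chain : almost_subset C [set n | forall j, j < m.-1 ->
    forall a c, x j n a -> x j.+1 n c -> immediate pieces a c].
  by apply: almost_ball => j lt; apply: chain; lia.
have core := almost_and first (almost_and all_in all_chain).
have last : almost_subset C [set n | forall a d, x 0 n a -> x m.-1 n d ->
    exists i, [/\ odd i, a = element i 0 (M i./2).-1, d = element i 0 (M i./2 - m) &
    m <= M i./2]].
  apply: almost_mono core => n [Hf [Hin Hch]] a d pa pd.
  have [oa sa fa] := Hf a pa; pose i := index a.
  have Ea : a = element i 0 (M i./2).-1 by rewrite (elemE a) sa -fa.
  suff Hj j : j < m -> forall c, x j n c ->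
      j < M i./2 /\ c = element i 0 ((M i./2).-1 - j).
    have [lt ->] := Hj _ lt_last d pd; exists i; split=> //; last lia.
    by congr element; lia.
  elim: j => [|j IH] lt c pc.
    by rewrite (pc_functional (cx 0 m0) pc pa) subn0; split=> //; rewrite -fa.
  have [c' pc'] := Hin j (ltnW lt); have [lt' Ec'] := IH (ltnW lt) c' pc'.
  have im := Hch j (ltac:(lia)) c' c pc' pc.
  have q0 : 0 < (M i./2).-1 - j.
    rewrite lt0n; apply/eqP => q0; move: im; rewrite Ec' q0.
    exact: core_end_no_succ.
  split; first lia.
  apply: immediate_succ_unique im _; rewrite Ec'.
  have -> : (M i./2).-1 - j = ((M i./2).-1 - j.+1).+1 by lia.
  apply: immediate_offset; last by rewrite oa /=; lia.
  by rewrite /in_pieces !elementE oa /=; lia.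
have [c0 al] := (cx _ lt_last, ax _ lt_last).
have [|H|H] := cohesive_decides (b := fun a => 0 < offset a) cohC _ c0 al.
- by comput.
- case: (@no_succ (fun a => element (index a) (slot a) (offset a).-1)).
    by rewrite /element; comput.
  apply: almost_mono (almost_and H (almost_and last (ax 0 m0))).
  move=> n [Hn [Hl [a pa]]] d pd; have [i [oi _ Ed le]] := Hl a d pa pd.
  have := Hn d pd; rewrite Ed !elementE => q0.
  rewrite -{1}(prednK q0); apply: immediate_offset.
    by rewrite /in_pieces !elementE oi /=; lia.
  by rewrite oi /=; lia.
case: (@no_pred (fun a => element (index a).-1
    (last_slot (index a)./2 (b (index a)./2)) 0)).
  rewrite /element /last_slot; apply: computes_pair; first comput.
  apply: computes_pair; last comput.
  apply: computes_iteri; [| |comput].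
    by apply: computes_succ; apply: (computes_comp cb); comput.
  by apply: computes_if; [apply: cG|..]; comput.
apply: almost_mono (almost_and H (almost_and last (ax _ lt_last))).
move=> n [Hn [Hl [d pd]]] a pa; have [i [oi -> Ed le]] := Hl a d pa pd.
have Mi : M i./2 = m.
  by have := Hn d pd; rewrite Ed !elementE; lia.
have [l1 l2] := last_slotP (Hb _ Mi).
have Ei : i = i./2.*2.+1 by have := odd_double_half i; rewrite oi; lia.
have M0 : 0 < M i./2 by lia.
rewrite !elementE; have -> : i.-1 = i./2.*2 by rewrite {1}Ei.
by have := core_pred_last M0 l1 l2; rewrite -Ei.
Qed.

End Pieces.

(** * Searching for blocks in a presentation *)

Section Search.
Variables (P : structure nat) (m : nat -> nat).
Hypothesis m0 : forall w, 0 < m w.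
Hypothesis cm : forall g f, computes g f -> computes g (fun z => m (f z)).

Definition in_dom (g : nat -> nat) (x : nat) : bool := g x.*2 == 1.
Definition in_prec (g : nat -> nat) (x y : nat) : bool := g (npair x y).*2.+1 == 1.

(** Matrix of the exists-forall-exists form of [block P (m w)]: [x] codes the
    block, [y] is an element of the order, and [z] packs an element between [y]
    and the first of the block with one between the last of the block and [y]. *)
Definition block_matrix (g : nat -> nat) (w x y z : nat) : bool :=
  let X := nth_code x in
  [&& ball (m w) (fun j => in_dom g (X j)),
      ball (m w).-1 (fun j => in_prec g (X j) (X j.+1) &&
        ~~ (in_prec g (X j) y && in_prec g y (X j.+1))),
      in_prec g y (X 0) ==> in_prec g y (p1 z) && in_prec g (p1 z) (X 0) &
      in_prec g (X (m w).-1) y ==>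
        in_prec g (X (m w).-1) (p2 z) && in_prec g (p2 z) y].

Lemma decides_block_matrix g w x y z : computes g w -> computes g x ->
  computes g y -> computes g z ->
  decides g (fun t => block_matrix g (w t) (x t) (y t) (z t)).
Proof.
move=> cw cx cy cz; rewrite /block_matrix /in_dom /in_prec; have cmw := cm cw.
repeat apply: decides_and; [apply: decides_ball|apply: decides_ball|..];
  comput.
Qed.

Let g := char (struct_set P).

Lemma in_domP x : in_dom g x <-> dom P x.
Proof.
rewrite /in_dom /g /char /struct_set /= odd_double doubleK.
by case: asboolP.
Qed.

Lemma in_precP x y : in_prec g x y <-> prec P x y.
Proof.
rewrite /in_prec /g /char /struct_set /= odd_double /= uphalf_double of_natE !pairK.
by case: asboolP.
Qed.

Lemma block_matrixP w :
  block P (m w) <-> exists x, forall y, exists z, block_matrix g w x y z.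
Proof.
have between a b : ~ immediate P a b ->
    exists z, in_prec g a b ==> in_prec g a z && in_prec g z b.
  move=> nim; case: (pselect (exists z, prec P a z /\ prec P z b)).
    by move=> [z [/in_precP az /in_precP zb]]; exists z; rewrite az zb implybT.
  move=> nz; exists 0; apply/implyP => /in_precP ab; case: nim; split=> // z zz.
  by apply: nz; exists z.
split=> [[X [dX XX Xl Xr]]|[x Hx]].
  have [i _|x Ex] := @finite_choice_code (fun i u => u = X i) (m w).
    by exists (X i).
  have lt : (m w).-1 < m w by have := m0 w; lia.
  exists x => y; have [z1 Hz1] := between y _ (Xl y); have [z2 Hz2] := between _ _ (Xr y).
  exists (npair z1 z2); rewrite /block_matrix !pairK (Ex 0) // (Ex _ lt) Hz1 Hz2 !andbT.
  apply/andP; split; apply/ballP => j ltj; first by rewrite Ex //; apply/in_domP/dX.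
  have ltj1 : j.+1 < m w by lia.
  rewrite (Ex _ ltj1) (Ex _ (ltnW ltj1)); have [/in_precP -> nb] := XX j ltj1.
  by apply/negP => /andP[/in_precP ? /in_precP ?]; apply: (nb y).
have not_between a b : (exists z,
    in_prec g a b ==> in_prec g a z && in_prec g z b) -> ~ immediate P a b.
  move=> [z +] [ab nb]; have /in_precP -> /= := ab.
  by move=> /andP[/in_precP ? /in_precP ?]; apply: (nb z).
exists (nth_code x); split.
- by have [z /and4P[/ballP H _ _ _]] := Hx 0 => j /H/in_domP.
- move=> j lt; have lt' : j < (m w).-1 by lia.
  split=> [|y []]; first by have [z /and4P[_ /ballP/(_ j lt')/andP[/in_precP]]] := Hx 0.
  have [z /and4P[_ /ballP/(_ j lt')/andP[_ H] _ _]] := Hx y.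
  by move: H => /negP H /in_precP yl /in_precP yr; apply: H; rewrite yl yr.
- move=> y; apply: not_between; have [z /and4P[_ _ H _]] := Hx y.
  by exists (p1 z).
- move=> y; apply: not_between; have [z /and4P[_ _ _ H]] := Hx y.
  by exists (p2 z).
Qed.

(** Two jumps decide the forall-exists part of [block_matrixP]. *)
Lemma block_search : exists2 b : nat -> nat -> bool,
  decides (char (jump (jump (struct_set P)))) (fun t => b (p1 t) (p2 t)) &
  forall w, block P (m w) <-> exists x, b w x.
Proof.
pose Q1 : set nat := [set t | exists z,
  block_matrix g (p1 (p1 t)) (p2 (p1 t)) (p2 t) z]%classic.
pose Q2 : set nat := [set t | exists y, ~~ `[< Q1 (npair t y) >]]%classic.
have c1 : computes (char (jump (struct_set P))) (char Q1).
  apply: (computes_jump_complete (R := fun t z =>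
    block_matrix g (p1 (p1 t)) (p2 (p1 t)) (p2 t) z)) => //.
  by apply: decides_block_matrix; comput.
have c2 : computes (char (jump (jump (struct_set P)))) (char Q2).
  apply: (computes_jump_complete (R := fun t y => ~~ `[< Q1 (npair t y) >])) => //.
  have := computes_comp c1 (h := fun t => npair (p1 t) (p2 t)) (ltac:(comput)).
  by move=> /(decides_neg (b := fun t => `[< Q1 (npair (p1 t) (p2 t)) >])).
exists (fun w x => ~~ `[< Q2 (npair w x) >]) => [|w].
  have := computes_comp c2 (h := fun t => npair (p1 t) (p2 t)) (ltac:(comput)).
  by move=> /(decides_neg (b := fun t => `[< Q2 (npair (p1 t) (p2 t)) >])).
rewrite block_matrixP; split=> -[x Hx]; exists x.
  apply/asboolPn => -[y /asboolPn]; apply.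
  by rewrite /Q1 /= !pairK.
move=> y; apply: contrapT => nz; move: Hx => /asboolPn; apply.
by exists y; apply/asboolPn; rewrite /Q1 /= !pairK.
Qed.

End Search.

(** * The order *)

(** Piece [<n, <side, k>>] has a core whose size encodes [n] and the side, and
    tail slots at the stages at which [k] grows that side. *)
Definition core_size (n side : nat) : nat := n.*2 + (side != 0) + 2.
Definition piece_core (p : nat) : nat := core_size (p1 p) (p1 (p2 p)).
Definition piece_slots (p s : nat) : bool := grows (p1 (p2 p)) (p1 p) (p2 (p2 p)) s.

Definition race_order : structure nat := pieces piece_core piece_slots.

Lemma computes_piece_core g f :
  computes g f -> computes g (fun z => piece_core (f z)).
Proof. by move=> *; rewrite /piece_core /core_size; comput. Qed.

Lemma decides_piece_slots g f h : computes g f -> computes g h ->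
  decides g (fun z => piece_slots (f z) (h z)).
Proof. by move=> *; rewrite /piece_slots; comput. Qed.

Lemma core_size_inj n side n' side' :
  core_size n side = core_size n' side' -> n = n' /\ (side == 0) = (side' == 0).
Proof. rewrite /core_size; lia. Qed.

(** The events of almost all [i] in [C] are not bounded by a partial computable
    function, so on one of the two sides the growth is not so bounded either. *)
Lemma some_side_block (C : set nat) n : cohesive C -> exists side,
  block (cohesive_power race_order C) (core_size n side).
Proof.
move=> cohC; apply: contrapT => nblock.
have bound side : exists psi, partial_computable psi /\ almost_subset C
    [set i | exists2 v, psi i v & forall s, grows side n i s -> s <= v].
  apply: contrapT => unb; apply: nblock; exists side.
  apply: (block_of_unbounded computes_piece_core decides_piece_slots cohC
    (kappa := fun i => npair n (npair side i))).
  - by rewrite /core_size; lia.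
  - by comput.
  - by move=> i; rewrite /piece_core /= !pairK.
  - move=> psi cpsi H; apply: unb; exists psi; split=> //.
    by apply: almost_mono H => i; rewrite /piece_slots /= !pairK.
have [psi0 [c0 H0]] := bound 0; have [psi1 [c1 H1]] := bound 1.
have csum := pc_comp (f := fun c => maxn (p1 c) (p2 c)) (ltac:(comput)) (pc_pair c0 c1).
have [N HN] := events_dominate csum.
have [i [_ leN]] := almost_inhabited N cohC.1 (almost_and H0 H1).
move=> [[v0 p0 b0] [v1 p1i b1]].
have [|s es lts] := HN i (maxn v0 v1) leN.
  by exists (npair v0 v1); rewrite ?pairK //; exists v0, v1.
have : grows 0 n i s || grows 1 n i s by rewrite /grows es; case: (leads _ _ _).
by case/orP => [/b0|/b1]; move: lts; rewrite gtn_max => /andP[]; lia.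
Qed.

(** The true value bounds the growth of its side, computably. *)
Lemma side_block_sound (C : set nat) n side : cohesive C ->
  block (cohesive_power race_order C) (core_size n side) ->
  ~ varphi (char (jump (jump set0))) n n (side == 0).
Proof.
move=> cohC blk /(grows_bounded (fun=> 0))[b cb Hb]; move: blk.
apply: (no_block_of_bounded computes_piece_core decides_piece_slots cohC
  (b := fun p => b (p2 (p2 p)))).
- by rewrite /core_size; lia.
- by apply: (computes_comp cb); comput.
- move=> p /core_size_inj[En Es] s; rewrite /piece_slots /grows En Es => gr.
  exact: Hb.
Qed.

(** The search for a side whose block occurs ends by [some_side_block], and the
    side that it finds excludes one of the values 0 and 1 by [side_block_sound]. *)
Lemma presentation_PA (C : set nat) (P : structure nat) : cohesive C ->
  presentation P (cohesive_power race_order C) ->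
  PA_degree (char (jump (jump set0))) (char (jump (jump (struct_set P)))).
Proof.
move=> cohC [structP iso].
have blockE n side : block P (core_size n side) <->
    block (cohesive_power race_order C) (core_size n side).
  apply: block_isomorphic iso; first by rewrite /core_size; lia.
    exact: structP.2.
  exact: power_prec_dom.
have [b cb Hb] := @block_search P (fun w => core_size (p1 w) (p2 w))
  (fun w => ltac:(by rewrite /core_size; lia))
  (fun g f cf => ltac:(by rewrite /core_size; comput)).
have [||x cx Hx] := @computes_min (char (jump (jump (struct_set P))))
    (fun e x => b (npair e (p1 x)) (p2 x)).
- by apply: (decides_comp2 cb); comput.
- move=> e; have [side /blockE H] := some_side_block e cohC.
  have := Hb (npair e side); rewrite !pairK => -[/(_ H)[y by_] _].
  by exists (npair side y); rewrite !pairK.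
exists (fun e => nat_of_bool (p1 (x e) == 0)); first by comput.
split=> [e|e v ev Ev]; first by case: (_ == 0); [right|left].
have := Hb (npair e (p1 (x e))); rewrite !pairK => -[_ Hblk].
have /Hblk/blockE/(side_block_sound cohC) : exists y, b (npair e (p1 (x e))) y.
  by exists (p2 (x e)).
by rewrite Ev.
Qed.

Lemma DNC2_not_computed g h : DNC2 g h -> ~ computes g h.
Proof. by move=> [_ dnc] [e He]; apply: (dnc e (h e) (He e)). Qed.

Theorem theorem4p3 :
  exists L : structure nat,
    [/\ linear_order L,
        computable (struct_set L),
        forall (C : set nat) (P : structure nat),
          cohesive C -> presentation P (cohesive_power L C) ->
          PA_degree (char (jump (jump set0)))
                    (char (jump (jump (struct_set P)))) &
        forall C : set nat, cohesive C ->
          ~ exists P : structure nat,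
              presentation P (cohesive_power L C) /\ computable (struct_set P)].
Proof.
exists race_order; split; [exact: pieces_linear| |exact: presentation_PA|].
  exact: (pieces_computable computes_piece_core decides_piece_slots).
move=> C cohC [P [presP compP]].
have [h hP /DNC2_not_computed] := presentation_PA cohC presP; apply.
apply: computes_trans hP; do 2 apply: computes_jump.
by rewrite char_set0.
Qed.
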